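(* There exists a standard Gaussian vector $X=(X_1,X_2,X_3,X_4)$ such that $X^h$ is a color process for all small positive $h$ but is not a color process for any large $h$; that is, there are $0<h_0\le h_1<\infty$ such that $X^h$ is a color process for every $h\in(0,h_0)$ and $X^h$ is not a color process for any $h>h_1$.
   Context: A $\{0,1\}$-valued process $(Y_i)_{i\in S}$ is a color process (divide and color process) if there are $p\in[0,1]$ and a random partition $\pi$ of $S$ such that $(Y_i)$ has the same law as the process obtained by sampling $\pi$ and then, independently of $\pi$ and independently for different partition elements, assigning all elements of a partition element the value $1$ with probability $p$ and the value $0$ with probability $1-p$. For a random vector $X=(X_i)$ and $h\in\mathbb{R}$, $X^h=(X^h_i)$ with $X^h_i=I(X_i>h)$. A Gaussian vector is standard if each marginal has mean zero and variance one. All Gaussian vectors are assumed nondegenerate: $P(X_i\ne X_j)=1$ for $i\neq j$. *)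

(* Defs.v *)
From HB Require Import structures.
From mathcomp Require Import all_boot all_order all_algebra.
From mathcomp Require Import all_classical all_reals all_analysis.

Set Implicit Arguments.
Unset Strict Implicit.
Unset Printing Implicit Defensive.

Import Order.TTheory GRing.Theory Num.Theory.

Local Open Scope classical_set_scope.
Local Open Scope ring_scope.

(* [normal_prob m 0] is by convention the uniform law on [0, 1]; the Gaussian
   law of variance zero is the point mass at its mean. *)
Definition gaussian_law (R : realType) (m s : R) : set R -> \bar R :=
  if s == 0 then dirac m else normal_prob m s.

Section gaussian_vector.
Context d (T : measurableType d) (R : realType) (P : probability T R)
  (I : finType).
Implicit Types X : I -> {RV P >-> R}.

(* Singular covariance matrices are allowed. *)
Definition gaussian_vector X :=
  forall a : I -> R, exists m s : R, forall A : set R, measurable A ->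
    P ((fun t => \sum_(i : I) a i * X i t) @^-1` A) = gaussian_law m s A.

Definition standard_gaussian_vector X :=
  gaussian_vector X /\
  forall i : I, ('E_P[X i] = 0 /\ 'V_P[X i] = 1)%E.

Definition nondegenerate_vector X :=
  forall i j : I, i != j -> P [set t | X i t != X j t] = 1%E.

End gaussian_vector.

Section threshold.
Context d (T : measurableType d) (R : realType) (P : probability T R).
Variables (X : {RV P >-> R}) (h : R).

Definition threshold (t : T) : bool := h < X t.

Lemma measurable_threshold : measurable_fun [set: T] threshold.
Proof. by apply: measurable_realfun.measurable_fun_ltr => //; exact: measurable_funP. Qed.

HB.instance Definition _ :=
  isMeasurableFun.Build _ _ _ _ threshold measurable_threshold.

Definition thresholdRV : {RV P >-> bool} := threshold.

End threshold.

Section color_process.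
Context (R : realType) (S : finType).

(* The law of a random partition of [S], given by its mass function. *)
Definition random_partition (mu : {set {set S}} -> R) :=
  [/\ forall Q, 0 <= mu Q,
      forall Q, ~~ finset.partition Q [set: S]%SET -> mu Q = 0
    & \sum_(Q : {set {set S}}) mu Q = 1].

(* Probability that coloring the blocks of [Q] independently, each [true] with
   probability [p], yields [y]: sum over all colorings [c] of the blocks that
   induce [y] on [S]. *)
Definition coloring_pmf (p : R) (Q : {set {set S}}) (y : {ffun S -> bool}) : R :=
  \sum_(c : {ffun {B : {set S} | B \in Q} -> bool}
         | [forall B : {B : {set S} | B \in Q}, forall i in val B, y i == c B])
    \prod_(B : {B : {set S} | B \in Q}) bernoulli_pmf p (c B).

Definition color_pmf (p : R) (mu : {set {set S}} -> R) (y : {ffun S -> bool}) : R :=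
  \sum_(Q : {set {set S}}) mu Q * coloring_pmf p Q y.

Definition color_process d (T : measurableType d) (P : probability T R)
    (Y : S -> {RV P >-> bool}) :=
  exists (p : R) (mu : {set {set S}} -> R),
    [/\ 0 <= p <= 1, random_partition mu
      & forall y : {ffun S -> bool},
          P [set t | forall i, Y i t = y i] = (color_pmf p mu y)%:E].

End color_process.

(* Main.v *)
From HB Require Import structures.
Require Import Defs.
From mathcomp Require Import all_boot all_order all_algebra.
From mathcomp Require Import all_classical all_reals all_analysis.
From mathcomp Require Import measurable_realfun ring lra.

Import Order.TTheory GRing.Theory Num.Theory.
Import numFieldNormedType.Exports.
Local Open Scope classical_set_scope.
Local Open Scope ring_scope.

(**
With Z, U, V independent standard Gaussians and W = (U, V, -U, -V), take
X_i = (Z + tau W_i) / sqrt (1 + tau^2) for a small tau > 0, so that the four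
vectors form a square on the sphere and X_0 + X_2 = X_1 + X_3. Hence for h > 0
the patterns 1010 and 0101 never occur, and a color representation can only
charge partitions having two neighbouring corners in a common block.

For large h this is impossible: some pair of neighbours would exceed h with
probability at least p = P(X_0 > h), whereas the mean of two neighbours is
Gaussian of variance < 1, so this event has probability o(p).

For small h, the symmetry of the square leaves a linear system for the weights
of the four kinds of admissible partitions. With Delta = P(1000) - P(0111), its
solution is nonnegative as soon as 0 <= Delta <= 2 (1 - 2p) min(P(0111), P(1100))
and 4 P(1000) + 2 P(1100) <= p (1 - p). Conditioning on (U, V), Delta is the
integral over |V| < U of k(tau |V|) - k(tau U), where
k(x) = Phi(s - x) + Phi(s + x) and s = h sqrt (1 + tau^2). As k is nonincreasing
and nearly constant, Delta >= 0 and Delta = O(h tau^2), while 1 - 2p is of order h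
and P(0111), P(1100) are of order tau.
*)

(** * Gaussian laws *)

Section normal_integral.
Context {R : realType}.
Local Notation mu := (@lebesgue_measure R).
Local Open Scope ereal_scope.

(** The abstract Radon-Nikodym derivative is known only almost everywhere. It is identified with
    [normal_pdf] because both have the same integral over every measurable set. *)
Lemma ge0_integral_normal_prob (m s : R) (f : R -> \bar R) :
  measurable_fun [set: R] f -> (forall x, 0 <= f x) ->
  \int[normal_prob m s]_x f x = \int[mu]_x (f x * (normal_pdf m s x)%:E).
Proof.
move=> mf f0.
rewrite -(Radon_Nikodym_SigmaFinite.change_of_variables
  (normal_prob_dominates m s) _ measurableT)//.
apply: ae_eq_integral => //.
- apply: emeasurable_funM => //; apply: (measurable_int mu).
  exact: Radon_Nikodym_SigmaFinite.f_integrable (normal_prob_dominates m s).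
- apply: emeasurable_funM => //; apply/measurable_EFinP.
  exact: measurable_normal_pdf.
- apply: ae_eqe_mul2l; apply: integral_ae_eq => //.
  + exact: Radon_Nikodym_SigmaFinite.f_integrable (normal_prob_dominates m s).
  + by apply/measurable_EFinP; exact: measurable_normal_pdf.
  + move=> E _ mE.
    by rewrite -Radon_Nikodym_SigmaFinite.f_integral//; exact: normal_prob_dominates.
Qed.

(** By uniqueness of Lebesgue measure it suffices to compare the two sides on intervals []x, y]]. A
    negative [a] reverses the interval and moves its closed end to the left, hence the two cases. *)
Lemma lebesgue_measure_affine (a b : R) (A : set R) : (a != 0)%R ->
  measurable A -> mu A = `|a|%:E * mu ((fun x => a * x + b)%R @^-1` A).
Proof.
move=> a0 mA; pose f (x : measurableTypeR R) : measurableTypeR R := (a * x + b)%R.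
have mf : measurable_fun [set: measurableTypeR R] f.
  by apply: measurable_funD => //; exact: measurable_funM.
pose nu : {measure set (measurableTypeR R) -> \bar R} :=
  mscale (NngNum (normr_ge0 a))
    (measure_function_pushforward__canonical__measure_function_Measure mu mf).
rewrite (@lebesgue_measure_unique R nu)// => _ [[x y] _ <-].
rewrite /nu/= /mscale/= /pushforward.
have [a_lt0|a_gt0|/eqP] := ltrgtP a 0; last by rewrite (negbTE a0).
  have -> : f @^-1` `]x, y] = `[((y - b) / a)%R, ((x - b) / a)%R[%classic.
    by apply/seteqP; split => z; rewrite /f/= !in_itv/= ltr_ndivlMr//
      ler_ndivrMr// (mulrC z) ltrBlDr lerBrDr => /andP[-> ->].
  rewrite !lebesgue_measure_itv/= !lte_fin ltr_nM2r ?invr_lt0// ltrD2r.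
  case: ifPn => _; last by rewrite mule0.
  by rewrite -!EFinB -EFinM ltr0_norm//; congr EFin; field.
have -> : f @^-1` `]x, y] = `]((x - b) / a)%R, ((y - b) / a)%R]%classic.
  by apply/seteqP; split => z; rewrite /f/= !in_itv/= ltr_pdivrMr// ler_pdivlMr//
    (mulrC z) ltrBlDr lerBrDr.
rewrite !lebesgue_measure_itv/= !lte_fin ltr_pM2r ?invr_gt0// ltrD2r.
case: ifPn => _; last by rewrite mule0.
by rewrite -!EFinB -EFinM gtr0_norm//; congr EFin; field.
Qed.

Lemma ge0_integral_affine (a b : R) (f : R -> \bar R) : (a != 0)%R ->
  measurable_fun [set: R] f -> (forall x, 0 <= f x) ->
  \int[mu]_x f x = `|a|%:E * \int[mu]_x f (a * x + b)%R.
Proof.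
move=> a0 mf f0; pose g (x : measurableTypeR R) : measurableTypeR R := (a * x + b)%R.
have mg : measurable_fun [set: measurableTypeR R] g.
  by apply: measurable_funD => //; exact: measurable_funM.
pose nu : {measure set (measurableTypeR R) -> \bar R} :=
  mscale (NngNum (normr_ge0 a))
    (measure_function_pushforward__canonical__measure_function_Measure mu mg).
rewrite (@eq_measure_integral _ _ _ _ nu)//; last first.
  by move=> A mA _; exact: (lebesgue_measure_affine a b).
rewrite ge0_integral_mscale//=; congr (_ * _).
exact: ge0_integral_pushforward.
Qed.

Lemma normal_pdf_affine (a b x : R) : (a != 0)%R ->
  (`|a| * normal_pdf b a (a * x + b) = normal_pdf 0 1 x)%R.
Proof.
move=> a0; rewrite !normal_pdfE ?oner_neq0// mulrA; congr (_ * _)%R.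
  rewrite /normal_peak expr1n mul1r -mulrnAr sqrtrM ?sqr_ge0// sqrtr_sqr.
  by rewrite invfM mulrA mulfV ?mul1r// normr_eq0.
rewrite /normal_fun addrK subr0 expr1n; congr expR; field.
by rewrite a0.
Qed.

Lemma normal_prob_affine (a b : R) (A : set R) : (a != 0)%R -> measurable A ->
  normal_prob 0 1 ((fun x => a * x + b)%R @^-1` A) = normal_prob b a A.
Proof.
move=> a0 mA; rewrite /normal_prob.
rewrite integral_mkcond [RHS]integral_mkcond.
rewrite [RHS](ge0_integral_affine a b)//; last 2 first.
- apply/(measurable_restrictT _ mA)/measurable_funTS.
  by apply/measurable_EFinP; exact: measurable_normal_pdf.
- move=> x; rewrite patchE; case: ifP => // _.
  by rewrite lee_fin normal_pdf_ge0.
rewrite -ge0_integralZl//.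
- apply: eq_integral => x _; rewrite !patchE.
  have -> : (x \in (fun x => a * x + b)%R @^-1` A) = ((a * x + b)%R \in A) by [].
  by case: ifP => _; rewrite ?mule0// -EFinM normal_pdf_affine.
- have mg : measurable_fun [set: R] (fun x : R => a * x + b)%R.
    by apply: measurable_funD => //; exact: measurable_funM.
  apply: (@measurableT_comp _ _ _ _ _ _ ((fun x => (normal_pdf b a x)%:E) \_ A)) => //.
  apply/(measurable_restrictT _ mA)/measurable_funTS.
  by apply/measurable_EFinP; exact: measurable_normal_pdf.
- move=> x _; rewrite patchE; case: ifP => // _.
  by rewrite lee_fin normal_pdf_ge0.
Qed.

End normal_integral.

(** * Sums of independent centred Gaussians *)

Section gaussian_sum.
Context {R : realType}.
Local Notation mu := (@lebesgue_measure R).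
Local Notation RR := (measurableTypeR R).
Local Open Scope ereal_scope.

(** Bayes' formula for a Gaussian [x] observed with Gaussian noise: the joint density is the
    marginal density of [y] times the conditional density of [x] given [y]. *)
Lemma normal_pdf_complete_square (s c x y : R) : (s != 0)%R -> (c != 0)%R ->
  let S := Num.sqrt (s ^+ 2 + c ^+ 2) in
  (normal_pdf x c y * normal_pdf 0 s x =
   normal_pdf 0 S y * normal_pdf (y * s ^+ 2 / S ^+ 2) (s * c / S) x)%R.
Proof.
move=> s0 c0 S.
have SS : (S ^+ 2 = s ^+ 2 + c ^+ 2)%R by rewrite sqr_sqrtr// addr_ge0// sqr_ge0.
have S2 : (S ^+ 2 != 0)%R.
  by rewrite SS gt_eqF// addr_gt0// exprn_even_gt0.
have S0 : S != 0%R by apply: contra_neq S2 => ->; rewrite expr0n.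
rewrite !normal_pdfE//; last by rewrite !mulf_neq0// invr_neq0.
rewrite mulrACA [RHS]mulrACA; congr (_ * _)%R.
  rewrite /normal_peak -!invfM; congr (_^-1)%R.
  rewrite -[LHS]sqrtrM; last by rewrite mulrn_wge0// mulr_ge0 ?sqr_ge0 ?pi_ge0.
  rewrite -[RHS]sqrtrM; last by rewrite mulrn_wge0// mulr_ge0 ?sqr_ge0 ?pi_ge0.
  by congr Num.sqrt; field.
rewrite /normal_fun -!expRD; congr expR.
rewrite !subr0 !expr_div_n exprMn.
have -> : (c ^+ 2 = S ^+ 2 - s ^+ 2)%R by rewrite SS; ring.
field.
rewrite S0 s0/= andbT; have -> : (S ^+ 2 - s ^+ 2 = c ^+ 2)%R by rewrite SS; ring.
by rewrite expf_neq0.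
Qed.

(** As a function of the mean [x], this is the standard Gaussian measure of the [x]-section of the
    measurable set of pairs [(x, z)] with [c * z + x] in [A]. *)
Lemma measurable_normal_prob_mean (c : R) (A : set R) : measurable A -> c != 0%R ->
  measurable_fun [set: R] (fun x : R => normal_prob x c A).
Proof.
move=> mA c0.
pose B := ((fun p : RR * RR => c * p.2 + p.1 : RR)%R @^-1` A).
have mB : measurable B.
  rewrite -[B]setTI.
  apply: (_ : measurable_fun setT (fun p : RR * RR => c * p.2 + p.1 : RR)%R) => //.
  by apply: measurable_funD => //; exact: measurable_funM.
rewrite (_ : (fun x : R => _) = normal_prob 0 1 \o xsection B).
  exact: (measurable_fun_xsection (normal_prob 0 1)).
apply/funext => x/=; rewrite -normal_prob_affine//; congr (normal_prob _ _ _).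
by apply/seteqP; split => z; rewrite /xsection/= inE.
Qed.

Lemma normal_prob_indic (m s : R) (A : set R) : measurable A ->
  normal_prob m s A = \int[mu]_x (\1_A x * normal_pdf m s x)%:E.
Proof.
move=> mA; rewrite /normal_prob integral_mkcond; apply: eq_integral => x _.
by rewrite patchE indicE; case: ifP => _; rewrite (mul1r, mul0r).
Qed.

(** After Tonelli and completion of the square, the inner integral is that of a conditional density,
    hence 1, and the marginal density of the sum remains. *)
Lemma normal_prob_conv (s c : R) (A : set R) : (s != 0)%R -> (c != 0)%R ->
  measurable A ->
  \int[normal_prob 0 s]_x normal_prob x c A =
  normal_prob 0 (Num.sqrt (s ^+ 2 + c ^+ 2)) A.
Proof.
move=> s0 c0 mA; rewrite ge0_integral_normal_prob//; last first.
  exact: measurable_normal_prob_mean.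
set S := Num.sqrt _.
pose F (p : RR * RR) := (\1_A p.2 * normal_pdf p.1 c p.2 * normal_pdf 0 s p.1)%:E.
have F0 p : 0 <= F p by rewrite lee_fin !mulr_ge0// normal_pdf_ge0.
have mF : measurable_fun [set: RR * RR] F.
  apply/measurable_EFinP/measurable_funM; last first.
    by apply: measurableT_comp => //; exact: measurable_normal_pdf.
  apply: measurable_funM; first exact: measurableT_comp.
  (* Joint measurability: the density with mean [p.1] is the centred one evaluated at the difference
     [p.2 - p.1]. *)
  rewrite (_ : (fun _ => _) = (fun p : RR * RR => normal_pdf 0 c (p.2 - p.1)%R)).
    apply: (measurableT_comp (measurable_normal_pdf _ _)).
    exact: measurable_funB.
  by apply/funext => p; rewrite !normal_pdfE// /normal_fun subr0.
transitivity (\int[mu]_x \int[mu]_y F (x, y)).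
  apply: eq_integral => x _; rewrite normal_prob_indic// -ge0_integralZr//.
  - apply/measurable_EFinP/measurable_funM => //; exact: measurable_normal_pdf.
  - by move=> y _; rewrite lee_fin mulr_ge0// normal_pdf_ge0.
  - by rewrite lee_fin normal_pdf_ge0.
rewrite [LHS](fubini_tonelli F mF F0).
rewrite normal_prob_indic//; apply: eq_integral => y _.
under eq_integral => x _.
  rewrite /F/= -mulrA normal_pdf_complete_square// -/S mulrA EFinM; over.
rewrite ge0_integralZl//.
- by rewrite integral_normal_pdf mule1.
- by apply/measurable_EFinP; exact: measurable_normal_pdf.
- by move=> x _; rewrite lee_fin normal_pdf_ge0.
- by rewrite lee_fin mulr_ge0// normal_pdf_ge0.
Qed.

End gaussian_sum.

(** * The standard Gaussian distribution function and density *)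

Definition Phi {R : realType} (x : R) : R := fine (normal_prob (0:R) 1 `]-oo, x]).

Section Phi.
Context {R : realType}.
Local Notation mu := (@lebesgue_measure R).
Local Notation G := (normal_prob (0:R) 1).
Local Notation phi := (normal_pdf (0:R) 1).
Implicit Types x y : R.

Lemma PhiE x : G `]-oo, x] = (Phi x)%:E.
Proof. by rewrite fineK// fin_num_measure. Qed.

Lemma normal_prob_ocitv x y : x <= y -> G `]x, y] = (Phi y - Phi x)%:E.
Proof.
move=> xy; rewrite EFinB -!PhiE.
have -> : `]-oo, y]%classic = `]-oo, x] `|` `]x, y] :> set R.
  by rewrite -itv_bndbnd_setU// bnd_simp.
rewrite measureU//; last first.
  by apply/seteqP; split => // z []/=; rewrite !in_itv/= => zx /andP[/lt_geF]; rewrite zx.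
by rewrite addeAC subee ?add0e// fin_num_measure.
Qed.

Lemma is_derive_Phi x : is_derive x 1 Phi (phi x).
Proof.
have [d1 d2] : derivable Phi x 1 /\ Phi^`()%classic x = phi x.
  apply: (@continuous_FTC1 R phi -oo%O x (x + 1)) => //.
  - by rewrite ltrDl.
  - apply: (integrableS _ _ (@subsetT _ _)) => //.
    exact: integrable_normal_pdf.
  - exact: ltNyr.
  - by apply: continuous_normal_pdf; exact: oner_neq0.
by rewrite derive1E in d2; exact: DeriveDef d1 d2.
Qed.

Lemma Phi_mean_value x y : x <= y ->
  exists2 z, x <= z <= y & Phi y - Phi x = phi z * (y - x).
Proof.
move=> xy; have [|z zxy e] := @MVT_segment R Phi phi x y xy (fun z _ => is_derive_Phi z).
  apply: derivable_within_continuous => z _; by have [] := is_derive_Phi z.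
by exists z.
Qed.

Lemma phiE x : phi x = normal_peak 1 * expR (- (x ^+ 2 / 2)).
Proof.
rewrite normal_pdfE ?oner_neq0//; congr (_ * expR _).
by rewrite subr0 expr1n mulNr.
Qed.

Lemma phi_gt0 x : 0 < phi x.
Proof. by rewrite phiE mulr_gt0 ?expR_gt0// normal_peak_gt0// oner_neq0. Qed.

Lemma normal_peak1_le1 : normal_peak (1:R) <= 1.
Proof.
rewrite /normal_peak invf_le1; last first.
  by rewrite sqrtr_gt0 expr1n mul1r mulrn_wgt0// pi_gt0.
rewrite -[leLHS]sqrtr1 ler_wsqrtr// expr1n mul1r.
by have := pi_ge2 R; lra.
Qed.

Lemma phi_le1 x : phi x <= 1.
Proof. by apply: le_trans normal_peak1_le1; apply: normal_pdf_ub; exact: oner_neq0. Qed.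

Lemma phi_le x y : `|x| <= y -> phi y <= phi x.
Proof.
move=> xy; rewrite !phiE ler_wpM2l ?normal_peak_ge0// ler_expR lerN2.
by rewrite ler_pM2r// -(real_normK (num_real x)) lerXn2r// nnegrE (le_trans _ xy).
Qed.

Lemma Phi_sub_le x y : x <= y -> Phi y - Phi x <= y - x.
Proof.
move=> xy; have [z _ ->] := Phi_mean_value _ _ xy.
by rewrite ler_piMl ?subr_ge0// phi_le1.
Qed.

Lemma Phi_sub_ge r x y : - r <= x -> x <= y -> y <= r ->
  phi r * (y - x) <= Phi y - Phi x.
Proof.
move=> rx xy yr; have [z /andP[xz zy] ->] := Phi_mean_value _ _ xy.
rewrite ler_wpM2r ?subr_ge0// phi_le// ler_norml (le_trans rx xz)/=.
exact: le_trans yr.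
Qed.

Lemma le_Phi x y : x <= y -> Phi x <= Phi y.
Proof.
move=> xy; rewrite -subr_ge0; have [z _ ->] := Phi_mean_value _ _ xy.
by rewrite mulr_ge0 ?subr_ge0// ltW// phi_gt0.
Qed.

Lemma normal_prob_oy x : G `]x, +oo[ = (1 - Phi x)%:E.
Proof.
rewrite EFinB -PhiE -probability_setC//; congr (G _).
by rewrite setCitvl.
Qed.

Lemma normal_prob_opp (A : set R) : measurable A -> G (-%R @^-1` A) = G A.
Proof.
move=> mA.
transitivity (G ((fun x => -1 * x + 0) @^-1` A)).
  by congr (G _); apply/seteqP; split => z /=; rewrite mulN1r addr0.
have N10 : -1 != 0 :> R by rewrite oppr_eq0 oner_neq0.
rewrite (normal_prob_affine (-1) 0 A N10 mA) /normal_prob.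
apply: eq_integral => x _; rewrite !normal_pdfE ?oner_neq0//.
by rewrite /normal_peak /normal_fun sqrrN.
Qed.

Lemma PhiN x : Phi (- x) = 1 - Phi x.
Proof.
apply: EFin_inj; rewrite -PhiE -normal_prob_oy -normal_prob_opp//.
have -> : -%R @^-1` `]-oo, (- x)] = `[x, +oo[%classic.
  by apply/seteqP; split => z /=; rewrite !in_itv/= andbT lerN2.
(* The closed and the open half-line differ by the point [x], which is a null set. *)
rewrite -(@setU1itv _ _ _ _ false)// measureU//.
- rewrite [X in (X + _)%E](_ : _ = 0%E) ?add0e//.
  exact: integral_set1.
- by apply/seteqP; split => // z []/= ->; rewrite in_itv/= ltxx.
Qed.

Lemma Phi0 : Phi (0:R) = 1 / 2.
Proof. by have := PhiN 0; rewrite oppr0; lra. Qed.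

End Phi.

(** * The Gaussian second moment *)

Section moments.
Context {R : realType}.
Local Notation mu := (@lebesgue_measure R).
Local Notation G := (normal_prob (0:R) 1).
Local Notation phi := (normal_pdf (0:R) 1).
Implicit Types x y : R.

Lemma is_derive_phi x : is_derive x 1 phi (- x * phi x).
Proof.
rewrite phiE; have -> : phi = fun x => normal_peak 1 * expR (- (x ^+ 2 / 2)).
  by apply/funext => z; rewrite phiE.
by apply: is_derive_eq; rewrite /GRing.scale/=; field.
Qed.

(** [Phi] is the distribution function of the identity, seen as a random variable under the Gaussian
    law. *)
Lemma cvg_Phi : Phi x @[x --> +oo] --> (1:R).
Proof.
have m1 : measurable_fun [set: measurableTypeR R] (idfun : measurableTypeR R -> R).
  exact: measurable_id.
pose X : {RV (G : probability (measurableTypeR R) R) >-> R} :=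
  HB.pack (idfun : measurableTypeR R -> R) (isMeasurableFun.Build _ _ _ _ _ m1).
have := cvg_cdfy1 X.
have -> : cdf X = EFin \o Phi by apply/funext => x /=; rewrite -PhiE.
exact: fine_cvg.
Qed.

(** From [exp (x^2 / 2) >= 1 + x^2 / 2], the product is at most [2 / x]. *)
Lemma cvg_mul_phi : x * phi x @[x --> +oo] --> (0:R).
Proof.
apply: (@squeeze_cvgr _ _ _ _ (fun=> 0) (fun x => 2 * x^-1)).
- near=> x.
  have x0 : 0 < x by near: x; exact: nbhs_pinfty_gt.
  have D0 : 0 < 1 + x ^+ 2 / 2 by rewrite ltr_pwDl// divr_ge0// sqr_ge0.
  apply/andP; split; first by rewrite mulr_ge0 ?(ltW x0)// ltW// phi_gt0.
  apply: (@le_trans _ _ (x * (1 + x ^+ 2 / 2)^-1)).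
    rewrite ler_wpM2l ?(ltW x0)// phiE -[leRHS]mul1r.
    rewrite ler_pM ?normal_peak_ge0 ?expR_ge0// ?normal_peak1_le1//.
    by rewrite expRN lef_pV2 ?posrE ?expR_gt0 ?expR_ge1Dx.
  by rewrite ler_pdivrMr// mulrAC ler_pdivlMr//; nra.
- exact: cvg_cst.
- rewrite -[X in _ --> X](mulr0 2); apply: cvgM; first exact: cvg_cst.
  apply/gtr0_cvgV0; last by [].
  by near=> x; near: x; exact: nbhs_pinfty_gt.
Unshelve. all: by end_near. Qed.

(** By parity the integral is twice that over the positive half-line, where [Phi x - x * phi x] is a
    primitive of [x ^+ 2 * phi x] growing from 1/2 to 1. *)
Lemma normal_second_moment : (\int[G]_x (x ^+ 2)%:E = 1)%E.
Proof.
have cphi : continuous phi by apply: continuous_normal_pdf; exact: oner_neq0.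
have csq : continuous (fun x => x ^+ 2 * phi x).
  by move=> x; apply: cvgM; [exact: sqr_continuous|exact: cphi].
have f0 x : 0 <= x ^+ 2 * phi x by rewrite mulr_ge0 ?sqr_ge0// ltW// phi_gt0.
rewrite ge0_integral_normal_prob; last 2 first.
- by apply/measurable_EFinP; exact: measurable_funX.
- by move=> x; rewrite lee_fin sqr_ge0.
transitivity (\int[mu]_x (x ^+ 2 * phi x)%:E)%E; first by [].
rewrite ge0_symfun_integralT//; last first.
  by move=> x; rewrite /= !phiE sqrrN.
rewrite -set_itvcy.
have dF x : is_derive x 1 (fun x => Phi x - x * phi x) (x ^+ 2 * phi x).
  have ? := is_derive_phi x; have ? := is_derive_Phi x.
  by apply: is_derive_eq; rewrite /GRing.scale/=; ring.
rewrite (@ge0_continuous_FTC2y R _ (fun x => Phi x - x * phi x) 0 1)//.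
- by rewrite mul0r subr0 Phi0 -EFinB -EFinM; congr EFin; field.
- exact: continuous_subspaceT.
- by rewrite -[X in _ --> X]subr0; apply: cvgB; [exact: cvg_Phi|exact: cvg_mul_phi].
- have cF : {for 0, continuous (fun x => Phi x - x * phi x)}.
    by apply/differentiable_continuous/derivable1_diffP; have [] := dF 0.
  exact: cvg_at_right_filter cF.
- by move=> x _; rewrite derive1E; have [] := dF x.
Qed.

End moments.

(** * Variation of the Gaussian mass seen from a shifted centre *)

Section window.
Context {R : realType}.
Local Notation phi := (normal_pdf (0:R) 1).
Implicit Types s x y z : R.

(** The exponents of the two densities differ by [2 * s * z], and [1 - exp (- t) <= t]. *)
Lemma phi_sub_le s z : 0 <= s -> 0 <= z -> phi (s - z) - phi (s + z) <= 2 * s * z.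
Proof.
move=> s0 z0; rewrite !phiE -mulrBr.
set p := (s - z) ^+ 2 / 2; set q := (s + z) ^+ 2 / 2.
have pq : q - p = 2 * s * z by rewrite /p /q; field.
have p0 : 0 <= p by rewrite divr_ge0// sqr_ge0.
rewrite -pq; have qp0 : 0 <= q - p by rewrite pq !mulr_ge0.
have -> : expR (- p) - expR (- q) = expR (- p) * (1 - expR (- (q - p))).
  by rewrite mulrBr mulr1 -expRD; congr (_ - expR _); ring.
have e1 : 1 - expR (- (q - p)) <= q - p by have := expR_ge1Dx (- (q - p)); lra.
have e0 : 0 <= 1 - expR (- (q - p)).
  by rewrite subr_ge0 -[leRHS]expR0 ler_expR oppr_le0.
have ep : expR (- p) <= 1 by rewrite -[leRHS]expR0 ler_expR oppr_le0.
rewrite -[leRHS]mul1r ler_pM ?normal_peak_ge0 ?normal_peak1_le1// ?mulr_ge0 ?expR_ge0//.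
by rewrite (le_trans _ e1)// ler_piMl.
Qed.

(** The mean value theorem for [k], whose derivative at [z >= 0] lies between [- 2 * s * z] and 0.
    This controls the integrand of Delta, from below and from above. *)
Lemma Phi_window s x y : 0 <= s -> 0 <= x -> x <= y ->
  0 <= (Phi (s - x) + Phi (s + x)) - (Phi (s - y) + Phi (s + y)) <= 2 * s * y ^+ 2.
Proof.
move=> s0 x0 xy.
pose k z := Phi (s - z) + Phi (s + z).
have dk z : is_derive z 1 k (phi (s + z) - phi (s - z)).
  have d1 := is_derive_Phi (s + z); have d2 := is_derive_Phi (s - z).
  have D1 : is_derive z 1 (Phi \o (fun z => s + z)) (phi (s + z)).
    by apply: is_derive_eq; rewrite /GRing.scale/=; ring.
  have D2 : is_derive z 1 (Phi \o (fun z => s - z)) (- phi (s - z)).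
    by apply: is_derive_eq; rewrite /GRing.scale/=; ring.
  by rewrite addrC; exact: is_deriveD.
have [|z /itvP zxy e] := @MVT_segment R k (fun z => phi (s + z) - phi (s - z))
  x y xy (fun z _ => dk z).
  by apply: derivable_within_continuous => z _; have [] := dk z.
rewrite -/(k x) -/(k y) -opprB e -mulNr opprB.
have z0 : 0 <= z by rewrite (le_trans x0)// zxy.
have zy : z <= y by rewrite zxy.
have y0 : 0 <= y by exact: le_trans zy.
have h : phi (s + z) <= phi (s - z) by rewrite phi_le// ler_norml; lra.
rewrite mulr_ge0 ?subr_ge0//= expr2 mulrA ler_pM ?subr_ge0//; last first.
  by rewrite lerBlDr lerDl.
by rewrite (le_trans (phi_sub_le _ _ s0 z0))// ler_wpM2l// mulr_ge0.
Qed.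

End window.

(** * Gaussian laws with possibly zero variance *)

Section gaussian_law.
Context {R : realType}.
Local Notation RR := (measurableTypeR R).
Local Notation G := (normal_prob (0:R) 1).

(** The parameter may be negative and only its square matters. This lets [s] be replaced by the
    square root of [s ^+ 2]. *)
Lemma eq_gaussian_law (s s' : R) (A : set R) : s ^+ 2 = s' ^+ 2 ->
  gaussian_law 0 s A = gaussian_law 0 s' A.
Proof.
move=> ss; have e0 : (s == 0) = (s' == 0) by rewrite -sqrf_eq0 ss sqrf_eq0.
rewrite /gaussian_law e0; case: (boolP (s' == 0)) => [_|s'0]; first exact: erefl.
rewrite /normal_prob; apply: eq_integral => x _.
by rewrite !normal_pdfE ?e0// /normal_peak /normal_fun ss.
Qed.

(** Conditionally on the first coordinate the sum is Gaussian with mean [X]. The convolution formula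
    then applies, except when [c = 0], where the event is a cylinder, or [s = 0], where [X] has a
    point mass as law. *)
Lemma gaussian_law_add d (T : measurableType d) (P : probability T R)
    (X : T -> RR) (s c : R) :
  measurable_fun setT X ->
  (forall A : set R, measurable A -> P (X @^-1` A) = gaussian_law 0 s A) ->
  forall A : set R, measurable A ->
  (P \x G)%E ((fun t : T * RR => X t.1 + c * t.2) @^-1` A) =
  gaussian_law 0 (Num.sqrt (s ^+ 2 + c ^+ 2)) A.
Proof.
move=> mX lawX A mA.
have [->|c0] := eqVneq c 0.
  rewrite (_ : _ @^-1` A = (X @^-1` A) `*` [set: RR]); last first.
    by apply/seteqP; split => t /=; rewrite mul0r addr0 // => -[].
  rewrite product_measure1E//; last by rewrite -[_ @^-1` _]setTI; exact: mX.
  transitivity (P (X @^-1` A)).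
    by rewrite -[RHS]mule1; congr (_ * _)%E; exact: (probability_setT (normal_prob 0 1)).
  rewrite (lawX _ mA); apply: eq_gaussian_law.
  by rewrite expr0n addr0 sqr_sqrtr// sqr_ge0.
transitivity (\int[P]_w (normal_prob (X w) c A))%E.
  apply: eq_integral => w _; rewrite -normal_prob_affine//=.
  by congr (G _); apply/seteqP; split => z; rewrite /xsection/= inE/= addrC.
pose nu := measure_function_pushforward__canonical__measure_function_Measure P mX.
transitivity (\int[nu]_x (normal_prob x c A))%E.
  by rewrite ge0_integral_pushforward//; exact: measurable_normal_prob_mean.
have [s0|s0] := eqVneq s 0.
  rewrite (@eq_measure_integral _ _ _ _ (dirac (0 : RR))); last first.
    by move=> B mB _; rewrite /nu/= /pushforward lawX// /gaussian_law s0 eqxx.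
  rewrite integral_dirac//; last exact: measurable_normal_prob_mean.
  rewrite diracT mul1e.
  transitivity (gaussian_law 0 c A); first by rewrite /gaussian_law (negbTE c0).
  by apply: eq_gaussian_law; rewrite s0 expr0n add0r sqr_sqrtr// sqr_ge0.
rewrite (@eq_measure_integral _ _ _ _ (normal_prob 0 s)); last first.
  by move=> B mB _; rewrite /nu/= /pushforward lawX// /gaussian_law (negbTE s0).
rewrite normal_prob_conv// /gaussian_law gt_eqF// sqrtr_gt0 ltr_pwDl ?sqr_ge0//.
by rewrite exprn_even_gt0.
Qed.

End gaussian_law.

(** * Color representations *)

Section coloring.
Context {R : realType} {S : finType}.
Implicit Types (p : R) (Q : {set {set S}}) (y : {ffun S -> bool}).

Lemma sum_bernoulli_ffun (I : finType) p (b0 : I) : 0 <= p <= 1 ->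
  \sum_(c : {ffun I -> bool} | c b0) \prod_b bernoulli_pmf p (c b) = p.
Proof.
move=> p01.
(* The constraint at [b0] is absorbed into the factor there, so that the sum of products
   factorizes. *)
pose g b x := if b == b0 then (if x then p else 0) else bernoulli_pmf p x.
transitivity (\sum_(c : {ffun I -> bool}) \prod_b g b (c b)).
  rewrite big_mkcond/=; apply: eq_bigr => c _; case: ifPn => cb0.
    apply: eq_bigr => b _; rewrite /g; case: eqP => // ->.
    by rewrite cb0.
  by rewrite (bigD1 b0)//= /g eqxx (negbTE cb0) mul0r.
rewrite -(bigA_distr_bigA g) (bigD1 b0)//= big_bool /g eqxx /= addr0.
rewrite big1 ?mulr1// => b /negbTE bb0; rewrite big_bool/= bb0.
by rewrite /bernoulli_pmf/= addrC subrK.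
Qed.

Section partition.
Variables (Q : {set {set S}}) (pQ : finset.partition Q [set: S]%SET).

Lemma pblock_in i : finset.pblock Q i \in Q.
Proof. by apply: pblock_mem; rewrite (cover_partition pQ) finset.in_setT. Qed.

Definition blk i : {B : {set S} | B \in Q} := exist _ (finset.pblock Q i) (pblock_in i).

Lemma mem_blk i : i \in val (blk i).
Proof. by rewrite mem_pblock (cover_partition pQ) finset.in_setT. Qed.

Lemma blk_eq (B : {B : {set S} | B \in Q}) i : i \in val B -> blk i = B.
Proof.
move=> iB; apply: val_inj => /=; apply: def_pblock => //; last exact: valP.
exact: partition_trivIset pQ.
Qed.

Lemma compat_coloring (c : {ffun {B : {set S} | B \in Q} -> bool}) y :
  [forall B : {B : {set S} | B \in Q}, forall i in val B, y i == c B] =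
  (y == [ffun i => c (blk i)]).
Proof.
apply/idP/eqP => [/forallP yc|-> ].
  apply/ffunP => i; rewrite ffunE; apply/eqP.
  by have /forall_inP := yc (blk i); apply; exact: mem_blk.
apply/forallP => B; apply/forall_inP => i iB; rewrite ffunE.
by rewrite (blk_eq _ _ iB).
Qed.

(** Each coloring of the blocks induces exactly one pattern, so exchanging the sums turns an
    expectation over patterns into one over independent block colors. *)
Lemma sum_coloring_pmf p (F : {ffun S -> bool} -> R) :
  \sum_y F y * coloring_pmf p Q y =
  \sum_(c : {ffun {B : {set S} | B \in Q} -> bool})
    F [ffun i => c (blk i)] * \prod_B bernoulli_pmf p (c B).
Proof.
rewrite /coloring_pmf.
under eq_bigr do rewrite mulr_sumr.
rewrite (exchange_big_dep predT)//=; apply: eq_bigr => c _.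
under eq_bigl do rewrite compat_coloring.
by rewrite big_pred1_eq.
Qed.

Lemma coloring_pmf_ge0 p y : 0 <= p <= 1 -> 0 <= coloring_pmf p Q y.
Proof.
by move=> p01; apply: sumr_ge0 => c _; apply: prodr_ge0 => B _; exact: bernoulli_pmf_ge0.
Qed.

Lemma coloring_marginal p i : 0 <= p <= 1 ->
  \sum_(y : {ffun S -> bool} | y i) coloring_pmf p Q y = p.
Proof.
move=> p01; rewrite -[RHS](sum_bernoulli_ffun _ _ (blk i) p01) big_mkcond/=.
transitivity (\sum_(y : {ffun S -> bool}) (y i)%:R * coloring_pmf p Q y).
  by apply: eq_bigr => y _; case: (y i); rewrite ?mul1r ?mul0r.
rewrite sum_coloring_pmf [RHS]big_mkcond/=; apply: eq_bigr => c _.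
by rewrite ffunE; case: (c _); rewrite ?mul1r ?mul0r.
Qed.

(** The block [B] is colored 1 with probability [p], and this already forces [E]. *)
Lemma coloring_block_le p (E : pred {ffun S -> bool}) B : 0 <= p <= 1 -> B \in Q ->
  (forall y, (forall i, i \in B -> y i) -> E y) ->
  p <= \sum_(y : {ffun S -> bool} | E y) coloring_pmf p Q y.
Proof.
move=> p01 BQ BE; pose b : {B : {set S} | B \in Q} := exist _ B BQ.
rewrite -[leLHS](sum_bernoulli_ffun _ _ b p01).
apply: (@le_trans _ _ (\sum_(y : {ffun S -> bool}) (E y)%:R * coloring_pmf p Q y));
  last first.
  rewrite [leRHS]big_mkcond/=; apply: ler_sum => y _.
  by case: (E y); rewrite ?mul1r ?mul0r.
rewrite sum_coloring_pmf big_mkcond/=; apply: ler_sum => c _; case: ifPn => cb.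
  rewrite BE ?mul1r// => i iB; rewrite ffunE.
  by rewrite (_ : blk i = b)//; apply: blk_eq.
by rewrite mulr_ge0// prodr_ge0// => D _; exact: bernoulli_pmf_ge0.
Qed.

(** A pattern that is constant on blocks comes from a coloring, and every coloring has positive
    weight when [0 < p < 1]. *)
Lemma coloring_pmf_gt0 p y : 0 < p < 1 ->
  (forall B, B \in Q -> forall i j, i \in B -> j \in B -> y i = y j) ->
  0 < coloring_pmf p Q y.
Proof.
move=> /andP[p0 p1] yQ; have p01 : 0 <= p <= 1 by rewrite !ltW.
pose c : {ffun {B : {set S} | B \in Q} -> bool} :=
  [ffun B : {B : {set S} | B \in Q} => [exists i in val B, y i]].
rewrite /coloring_pmf (bigD1 c)/=; last first.
  apply/forallP => B; apply/forall_inP => i iB; rewrite ffunE; apply/eqP.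
  apply/idP/exists_inP => [yi|[j jB]]; first by exists i.
  by rewrite (yQ _ (valP B) i j).
rewrite ltr_wpDr//.
  by apply: sumr_ge0 => c' _; apply: prodr_ge0 => B _; exact: bernoulli_pmf_ge0.
apply: prodr_gt0 => B _; rewrite /bernoulli_pmf; case: (c B) => //.
by rewrite subr_gt0.
Qed.

End partition.

(* When [f] is idempotent, [f i] is a chosen representative of the block of [i]. *)
Definition rep_partition (f : S -> S) : {set {set S}} :=
  preim_partition f [set: S]%SET.

Lemma rep_partitionP f : finset.partition (rep_partition f) [set: S]%SET.
Proof. exact: preim_partitionP. Qed.

Lemma mem_pblock_rep f i j : (j \in finset.pblock (rep_partition f) i) = (f i == f j).
Proof.
rewrite /rep_partition /preim_partition pblock_equivalence_partition ?finset.in_setT//.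
by split => //; move=> /eqP ->.
Qed.

(** The blocks correspond to the fixed points of [f], so the product over blocks becomes a product
    over representatives. A pattern not constant on blocks gets no coloring. *)
Lemma coloring_pmf_rep p f y : (forall i, f (f i) = f i) ->
  coloring_pmf p (rep_partition f) y =
  if [forall i, y i == y (f i)] then \prod_(i | f i == i) bernoulli_pmf p (y i) else 0.
Proof.
move=> ff; have pQ := rep_partitionP f; set Q := rep_partition f.
have Bne (B : {B : {set S} | B \in Q}) : exists i, i \in val B.
  apply/set0Pn; apply: contraTneq (valP B) => ->.
  by have := partition0 pQ; rewrite /partition0; case/and3P: pQ.
(* [r] sends a block to its representative and [b] sends a point to its block; between blocks and
   fixed points of [f] they are mutually inverse. *)
pose r B := f (xchoose (Bne B)).
pose b := blk _ pQ.
have brep i : b (f i) = b i.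
  by apply: blk_eq; rewrite mem_pblock_rep ff.
have rb i : r (b i) = f i.
  by have := xchooseP (Bne (b i)); rewrite /= mem_pblock_rep eq_sym => /eqP.
have br B : b (r B) = B.
  by rewrite brep; apply: blk_eq; exact: xchooseP.
rewrite /coloring_pmf (eq_bigl _ _ (fun c => compat_coloring _ pQ c y)) -/b.
case: ifPn => [/forallP yf|]; last first.
  rewrite negb_forall => /existsP[i yfi]; rewrite big1// => c /eqP yc.
  by move: yfi; rewrite yc !ffunE -/b brep eqxx.
pose c0 : {ffun {B : {set S} | B \in Q} -> bool} :=
  [ffun B : {B : {set S} | B \in Q} => y (r B)].
rewrite (big_pred1 c0) => [|c]; last first.
  apply/eqP/eqP => [yc|->].
    by apply/ffunP => B; rewrite ffunE yc ffunE -/b br.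
  by apply/ffunP => i; rewrite !ffunE -/b rb; apply/eqP.
rewrite (reindex_onto b r)/=; last by move=> B _; exact: br.
apply: eq_big => [i|i]; first by rewrite rb.
by rewrite ffunE rb => /eqP ->.
Qed.

(** A list of weighted partitions, each given by a representative map; weights of entries describing
    the same partition add up. *)
Definition mixture (L : seq (R * (S -> S))) (Q : {set {set S}}) : R :=
  \sum_(k <- L) k.1 * (Q == rep_partition k.2)%:R.

Lemma sum_mixture L (F : {set {set S}} -> R) :
  \sum_Q mixture L Q * F Q = \sum_(k <- L) k.1 * F (rep_partition k.2).
Proof.
rewrite /mixture; under eq_bigr do rewrite mulr_suml.
rewrite exchange_big/=; apply: eq_bigr => k _.
rewrite (bigD1 (rep_partition k.2))//= eqxx mulr1 big1 ?addr0// => Q /negbTE ->.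
by rewrite mulr0 mul0r.
Qed.

Lemma random_partition_mixture L :
  all (fun k => 0 <= k.1) L -> \sum_(k <- L) k.1 = 1 ->
  random_partition (mixture L).
Proof.
move=> L0 L1; split.
- move=> Q; rewrite /mixture; elim: L L0 {L1} => [|k L IH /= /andP[k0 L0]].
    by rewrite big_nil.
  by rewrite big_cons addr_ge0 ?IH// mulr_ge0.
- move=> Q nQ; rewrite /mixture big1// => k _.
  case: eqP => [e|]; last by rewrite mulr0.
  by rewrite e rep_partitionP in nQ.
- transitivity (\sum_Q mixture L Q * 1); first by apply: eq_bigr => Q _; rewrite mulr1.
  by rewrite (sum_mixture L (fun=> 1)); under eq_bigr do rewrite mulr1.
Qed.

Lemma color_pmf_mixture p L y :
  color_pmf p (mixture L) y = \sum_(k <- L) k.1 * coloring_pmf p (rep_partition k.2) y.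
Proof. exact: (sum_mixture L (fun Q => coloring_pmf p Q y)). Qed.

End coloring.

(** * The explicit color representation on the square *)

Local Notation o0 := (@Ordinal 4 0 isT).
Local Notation o1 := (@Ordinal 4 1 isT).
Local Notation o2 := (@Ordinal 4 2 isT).
Local Notation o3 := (@Ordinal 4 3 isT).

Lemma big_I4 (T : Type) (idx : T) (op : Monoid.law idx) (F : 'I_4 -> T) :
  \big[op/idx]_(i < 4) F i = op (F o0) (op (F o1) (op (F o2) (F o3))).
Proof.
rewrite !big_ord_recl big_ord0 Monoid.mulm1.
by congr (op _ (op _ (op _ _))); congr F; exact: val_inj.
Qed.

Lemma forall_I4 (F : pred 'I_4) :
  [forall i, F i] = [&& F o0, F o1, F o2 & F o3].
Proof.
apply/forallP/and4P => [h|[h0 h1 h2 h3] i]; first by split; exact: h.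
by case: i => -[|[|[|[|//]]]] i4; [move: h0|move: h1|move: h2|move: h3];
  congr (is_true (F _)); exact: val_inj.
Qed.

Section square.
Context {R : realType}.
Implicit Types p A C M D : R.

(* [rep4 a b c d] lists the representatives of the blocks of 0, 1, 2, 3, where the
   corners of the square are numbered cyclically. *)
Definition rep4 (a b c d : 'I_4) (i : 'I_4) : 'I_4 :=
  match val i with 0 => a | 1 => b | 2 => c | _ => d end%N.

(** These are the eleven partitions with two neighbouring corners in a common block, grouped by
    shape: one block ([A]), a triple and a singleton ([C]), two opposite sides ([M]), one side and
    two singletons ([D]). *)
Definition square_mixture A C M D : seq (R * ('I_4 -> 'I_4)) :=
  [:: (A, rep4 o0 o0 o0 o0);
      (C, rep4 o0 o0 o0 o3); (C, rep4 o0 o0 o2 o0);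
      (C, rep4 o0 o1 o0 o0); (C, rep4 o0 o1 o1 o1);
      (M, rep4 o0 o0 o2 o2); (M, rep4 o0 o1 o1 o0);
      (D, rep4 o0 o0 o2 o3); (D, rep4 o0 o1 o1 o3);
      (D, rep4 o0 o1 o2 o2); (D, rep4 o0 o1 o2 o0)].

(* [n1], [n2], [n3]: probability of a given pattern with one 1, two neighbouring 1s,
   three 1s. *)
Definition square_pmf p n1 n2 n3 (b0 b1 b2 b3 : bool) : R :=
  match (b0 + b1 + b2 + b3)%N with
  | 0 => 1 - p - 3 * n1 - 2 * n2 - n3
  | 1 => n1
  | 2 => if b0 == b2 then 0 else n2
  | 3 => n3
  | _ => p - n1 - 2 * n2 - 3 * n3
  end.

(** The system to solve is [n1 = p (1 - p) (C + 2 D (1 - p))], [n3 = p (1 - p) (C + 2 D p)],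
    [n2 = p (1 - p) (M + D)]; total mass and marginal settle the constant patterns. The last four
    hypotheses yield in turn [D >= 0], [C >= 0], [M >= 0] and [A >= 0]. *)
Lemma square_color p n1 n2 n3 : 0 < p -> p < 1 / 2 -> 0 <= n1 - n3 ->
  n1 - n3 <= 2 * (1 - 2 * p) * n3 -> n1 - n3 <= 2 * (1 - 2 * p) * n2 ->
  4 * n1 + 2 * n2 <= p * (1 - p) ->
  exists mu : {set {set 'I_4}} -> R, random_partition mu /\
    forall y : {ffun 'I_4 -> bool},
      color_pmf p mu y = square_pmf p n1 n2 n3 (y o0) (y o1) (y o2) (y o3).
Proof.
move=> p0 p1 d0 d3 d2 n12.
have q0 : 0 < 1 - p by lra.
have r0 : 0 < 1 - 2 * p by lra.
(* [D], [C] and [M] are read off from the patterns 1000, 0111 and 1100. *)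
pose D := (n1 - n3) / (2 * (p * (1 - p)) * (1 - 2 * p)).
pose C := n1 / (p * (1 - p)) - 2 * D * (1 - p).
pose M := n2 / (p * (1 - p)) - D.
pose A := 1 - 4 * C - 2 * M - 4 * D.
have pq0 : 0 < p * (1 - p) by rewrite mulr_gt0.
have D0 : 0 <= D by rewrite divr_ge0// !mulr_ge0// ltW.
have C0 : 0 <= C.
  have -> : C = (n3 * (1 - 2 * p) - (n1 - n3) * p) / (p * (1 - p) * (1 - 2 * p)).
    by rewrite /C /D; field; rewrite !gt_eqF.
  by rewrite divr_ge0//; [nra|rewrite mulr_ge0// ltW].
have M0 : 0 <= M.
  have -> : M = (2 * (1 - 2 * p) * n2 - (n1 - n3)) / (2 * (p * (1 - p)) * (1 - 2 * p)).
    by rewrite /M /D; field; rewrite !gt_eqF.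
  by rewrite divr_ge0// ?subr_ge0// !mulr_ge0// ltW.
have A0 : 0 <= A.
  have -> : A = (p * (1 - p) - (4 * n1 + 2 * n2)) / (p * (1 - p)) + D * (8 * (1 - p) - 2).
    by rewrite /A /C /M; field; rewrite !gt_eqF.
  by rewrite addr_ge0// mulr_ge0// ?invr_ge0 ?subr_ge0// ?(ltW pq0)//; lra.
exists (mixture (square_mixture A C M D)); split.
  apply: random_partition_mixture; first by rewrite /= A0 C0 M0 D0.
  by rewrite !big_cons big_nil /=/A; ring.
move=> y; rewrite color_pmf_mixture !big_cons big_nil/=.
rewrite !coloring_pmf_rep; do ?by move=> i; case: i => -[|[|[|[|//]]]] i4.
rewrite !forall_I4.
(* One product of Bernoulli weights for each of the eleven partitions; then the sixteen patterns are
   checked one by one. *)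
do 11 rewrite [\prod_(i | _) _]big_mkcond/= big_I4/=.
rewrite /rep4/= !eqE/= /square_pmf /bernoulli_pmf.
case: (y o0); case: (y o1); case: (y o2); case: (y o3) => /=;
  rewrite ?mulr0 ?addr0 ?mulr1 ?mul1r ?add0r /A /C /M /D /unstable.onem; field;
  by rewrite ?gt_eqF.
Qed.
End square.

(** * What a pattern of probability zero forces *)

Section obstruction.
Context {R : realType} {S : finType}.
Implicit Types (p : R) (y a : {ffun S -> bool}).

Lemma color_pmf_marginal p (mu : {set {set S}} -> R) i : 0 <= p <= 1 ->
  random_partition mu -> \sum_(y : {ffun S -> bool} | y i) color_pmf p mu y = p.
Proof.
move=> p01 [mu0 mup mu1]; rewrite /color_pmf exchange_big/=.
rewrite -[RHS]mul1r -mu1 mulr_suml; apply: eq_bigr => Q _; rewrite -mulr_sumr.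
have [pQ|/mup ->] := boolP (finset.partition Q [set: S]%SET); last by rewrite !mul0r.
by rewrite coloring_marginal.
Qed.

(** Every partition charged by [mu] has a block on which [a] is not constant, since otherwise [a]
    would have positive probability. With probability [p] that block is colored 1, and then two
    sites where [a] differs both carry 1. *)
Lemma color_pmf_eq0_le p (mu : {set {set S}} -> R) a : 0 < p < 1 ->
  random_partition mu -> color_pmf p mu a = 0 ->
  p <= \sum_(y : {ffun S -> bool} | [exists i, exists j, [&& a i != a j, y i & y j]])
         color_pmf p mu y.
Proof.
move=> p01 [mu0 mup mu1] a0.
have p01' : 0 <= p <= 1 by case/andP: p01 => ? ?; rewrite !ltW.
have col0 Q y : 0 <= coloring_pmf p Q y by exact: coloring_pmf_ge0.
rewrite /color_pmf exchange_big/= -[leLHS]mul1r -mu1 mulr_suml.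
apply: ler_sum => Q _; rewrite -mulr_sumr.
have [->|muQ] := eqVneq (mu Q) 0; first by rewrite !mul0r.
rewrite ler_wpM2l//.
have pQ : finset.partition Q [set: S]%SET.
  by apply: contraNT muQ => /mup ->.
have : coloring_pmf p Q a = 0.
  have /eqP := a0; rewrite psumr_eq0; last by move=> Q' _; rewrite mulr_ge0.
  by move=> /allP/(_ Q (mem_index_enum _))/=; rewrite mulf_eq0 (negbTE muQ) => /eqP.
move=> colQ; have [B BQ [i [j [iB jB aij]]]] :
    exists2 B, B \in Q & exists i, exists j, [/\ i \in B, j \in B & a i != a j].
  apply: contrapT => nB; suff : 0 < coloring_pmf p Q a by rewrite colQ ltxx.
  apply: coloring_pmf_gt0 => // B BQ i j iB jB.
  apply: contrapT => aij; apply: nB; exists B => //; exists i, j.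
  by split=> //; apply/eqP.
apply: (coloring_block_le _ pQ p _ B) => // y yB.
by apply/existsP; exists i; apply/existsP; exists j; rewrite aij !yB.
Qed.

End obstruction.

(** * Events determined by a finite-valued map *)

Section finite_values.
Context d (T : measurableType d) (R : realType) (P : probability T R).
Local Open Scope ereal_scope.

Lemma measurable_finite_values (J : finType) (Y : T -> J) (r : seq J) :
  (forall y, measurable [set t | Y t = y]) -> measurable [set t | Y t \in r].
Proof.
move=> mY; have -> : [set t | Y t \in r] = \big[setU/set0]_(y <- r) [set t | Y t = y].
  rewrite -bigcup_seq; apply/seteqP; split => t /=; first by exists (Y t).
  by case=> z /= zr ->.
exact: bigsetU_measurable.
Qed.

Lemma probability_finite_values (J : finType) (Y : T -> J) (E : pred J) :
  (forall y, measurable [set t | Y t = y]) ->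
  P [set t | E (Y t)] = \sum_(y | E y) P [set t | Y t = y].
Proof.
move=> mY.
have : uniq [seq y <- index_enum J | E y] by rewrite filter_uniq// index_enum_uniq.
rewrite -big_filter; set r := [seq y <- _ | _].
have -> : [set t | E (Y t)] = [set t | Y t \in r].
  by apply/seteqP; split => t /=; rewrite mem_filter mem_index_enum andbT.
elim: r => [_|y r IH /= /andP[yr /IH IHr]].
  by rewrite big_nil (_ : [set t | _] = set0) ?measure0// -subset0.
rewrite big_cons -IHr -measureU//.
- congr (P _); apply/seteqP; split => t /=; rewrite in_cons.
    by case/orP => [/eqP ->|]; [left|right].
  by case=> [->|->]; rewrite ?eqxx ?orbT.
- exact: measurable_finite_values.
- by apply/seteqP; split => // t [/= -> yr']; rewrite yr' in yr.
Qed.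

End finite_values.

(** * Comparison of Gaussian tails *)

Section tail.
Context {R : realType}.
Local Notation G := (normal_prob (0:R) 1).

(** The densities are compared pointwise: their ratio at [x] is [exp (- e x^2) / S] with [e > 0]
    because [S < 1], which is at most [k] for large [x]. *)
Lemma normal_tail_le (S k : R) : 0 < S -> S < 1 -> 0 < k ->
  exists2 h1 : R, 0 < h1 & forall h, h1 < h ->
    (normal_prob 0 S `]h, +oo[ <= k%:E * G `]h, +oo[)%E.
Proof.
move=> S0 S1 k0.
pose e := (S ^- 2 - 1) / 2.
have e0 : 0 < e.
  by rewrite divr_gt0// subr_gt0 invf_gt1 ?exprn_gt0// expr_lt1// ltW.
have Se0 : 0 < (k * S * e)^-1 by rewrite invr_gt0 mulr_gt0// mulr_gt0.
(* Beyond this point [x <= x ^+ 2], by the summand 1, and [k * S * e * x >= 1], so that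
   [k * S * exp (e x^2) >= 1]. *)
exists (1 + (k * S * e)^-1); first by rewrite addr_gt0.
move=> h h1; rewrite -ge0_integralZl//; last 3 first.
- by apply/measurable_EFinP/measurable_funTS; exact: measurable_normal_pdf.
- by move=> x _; rewrite lee_fin normal_pdf_ge0.
- by rewrite lee_fin ltW.
apply: ge0_le_integral => //.
- by move=> x _; rewrite lee_fin normal_pdf_ge0.
- by apply/measurable_EFinP/measurable_funTS; exact: measurable_normal_pdf.
- apply/measurable_EFinP/measurable_funTS/measurable_funM => //.
  exact: measurable_normal_pdf.
move=> x; rewrite /= in_itv/= andbT => hx; rewrite -EFinM lee_fin.
have x1 : 1 + (k * S * e)^-1 < x by exact: lt_trans hx.
rewrite phiE normal_pdfE ?gt_eqF//.
have -> : normal_peak S = normal_peak 1 / S.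
  rewrite /normal_peak expr1n mul1r -mulrnAr sqrtrM ?sqr_ge0// sqrtr_sqr.
  by rewrite gtr0_norm// invfM mulrC.
have -> : normal_fun 0 S x = expR (- (x ^+ 2 * e)) * expR (- (x ^+ 2 / 2)).
  rewrite /normal_fun subr0 -expRD; congr expR; rewrite /e; field.
  by rewrite gt_eqF.
set N := normal_peak 1; set E := expR (- (x ^+ 2 / 2)); set E' := expR _.
have -> : N / S * (E' * E) = N * E * (E' / S) by ring.
rewrite [leRHS]mulrC ler_wpM2l ?mulr_ge0 ?normal_peak_ge0 ?expR_ge0//.
rewrite ler_pdivrMr// /E' expRN -[leLHS]mul1r ler_pdivrMr ?expR_gt0//.
have xx : x <= x ^+ 2 by rewrite expr2 ler_peMr//; lra.
apply: (@le_trans _ _ (k * S * (x ^+ 2 * e))); last first.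
  rewrite ler_wpM2l ?mulr_ge0 ?(ltW k0) ?(ltW S0)//.
  by rewrite (le_trans _ (expR_ge1Dx _))// lerDr.
apply: (@le_trans _ _ (k * S * e * (k * S * e)^-1)).
  by rewrite mulfV// gt_eqF// -invr_gt0.
have -> : k * S * (x ^+ 2 * e) = k * S * e * x ^+ 2 by ring.
by rewrite ler_wpM2l//; [rewrite -invr_ge0 ltW|lra].
Qed.

End tail.

(** * The square vector *)

Section square_vector.
Context {R : realType}.
Local Notation RR := (measurableTypeR R).
Local Notation G := (normal_prob (0:R) 1).
Local Notation Omega := (RR * RR * RR)%type.
Local Notation P := ((G \x G) \x G)%E.

Definition corner (i : 'I_4) (w : RR * RR) : R :=
  match val i with 0 => w.1 | 1 => w.2 | 2 => - w.1 | _ => - w.2 end%N.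

Lemma measurable_corner i : measurable_fun [set: RR * RR] (corner i).
Proof.
rewrite /corner; case: (val i) => [|[|[|_]]].
- exact: measurable_fst.
- exact: measurable_snd.
- by apply: measurableT_comp => //; exact: measurable_fst.
- by apply: measurableT_comp => //; exact: measurable_snd.
Qed.

Definition scale (tau : R) : R := (Num.sqrt (1 + tau ^+ 2))^-1.

Lemma scale_gt0 tau : 0 < scale tau.
Proof. by rewrite invr_gt0 sqrtr_gt0 ltr_pwDl// sqr_ge0. Qed.

Lemma scale_sqr tau : scale tau ^+ 2 = (1 + tau ^+ 2)^-1.
Proof. by rewrite exprVn sqr_sqrtr// addr_ge0// sqr_ge0. Qed.

Definition square_fun (tau : R) (i : 'I_4) (t : Omega) : R :=
  scale tau * (t.2 + tau * corner i t.1).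

Lemma measurable_square_fun tau i : measurable_fun [set: Omega] (square_fun tau i).
Proof.
apply: measurable_funM => //; apply: measurable_funD; first exact: measurable_snd.
apply: measurable_funM => //; apply: (measurableT_comp (measurable_corner i)).
exact: measurable_fst.
Qed.

HB.instance Definition _ tau i :=
  isMeasurableFun.Build _ _ _ _ (square_fun tau i) (measurable_square_fun tau i).

Definition square_vector tau (i : 'I_4) : {RV (P : probability Omega R) >-> R} :=
  square_fun tau i.

(** Two applications of [gaussian_law_add], starting from the law of [a * U], which is a point mass
    if [a = 0]. *)
Lemma law_linear (a b c : R) (A : set R) : measurable A ->
  P ((fun t : Omega => a * t.1.1 + b * t.1.2 + c * t.2) @^-1` A) =
  gaussian_law 0 (Num.sqrt (a ^+ 2 + b ^+ 2 + c ^+ 2)) A.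
Proof.
move=> mA.
have m1 : measurable_fun [set: RR] (fun x : RR => a * x : RR) by exact: measurable_funM.
have law1 (B : set R) : measurable B ->
    (G : probability RR R) ((fun x : RR => a * x) @^-1` B) = gaussian_law 0 a B.
  move=> mB; rewrite /gaussian_law; case: eqVneq => [->|a0].
    rewrite diracE; have [B0|B0] := boolP (0 \in B).
      have -> : (fun x : RR => 0 * x : RR) @^-1` B = setT.
        by apply/seteqP; split => // x _ /=; rewrite mul0r; exact: set_mem.
      exact: probability_setT.
    have -> : (fun x : RR => 0 * x : RR) @^-1` B = set0.
      apply/seteqP; split => // x /=; rewrite mul0r => /mem_set.
      by rewrite (negbTE B0).
    exact: measure0.
  rewrite -normal_prob_affine//=; congr (normal_prob _ _ _).
  by apply/seteqP; split => x /=; rewrite addr0.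
have m2 : measurable_fun [set: RR * RR] (fun w : RR * RR => a * w.1 + b * w.2 : RR).
  by apply: measurable_funD; exact: measurable_funM.
have law2 := gaussian_law_add _ _ _ _ _ b m1 law1.
have law3 := gaussian_law_add _ _ _ _ _ c m2 law2.
rewrite (law3 _ mA); congr (gaussian_law 0 (Num.sqrt (_ + _)) A).
by rewrite sqr_sqrtr// addr_ge0// sqr_ge0.
Qed.

End square_vector.

(** * Mean and variance of a standard Gaussian variable *)

Section standard_law.
Context {R : realType}.
Local Notation RR := (measurableTypeR R).
Local Notation G := (normal_prob (0:R) 1).

Lemma normal_abs_le : (\int[G]_x `|x|%:E <= 1)%E.
Proof.
have m2 : measurable_fun [set: R] (fun x : R => (x ^+ 2)%:E).
  by apply/measurable_EFinP; exact: measurable_funX.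
(* This uses [|x| <= (1 + x^2) / 2]. *)
apply: (@le_trans _ _ (\int[G]_x (2^-1 + 2^-1 * x ^+ 2)%:E)%E).
  apply: ge0_le_integral => //.
  - by apply/measurable_EFinP; exact: normr_measurable.
  - apply/measurable_EFinP; apply: measurable_funD => //.
    by apply: measurable_funM => //; exact: measurable_funX.
  - move=> x _; rewrite lee_fin.
    have : 0 <= (`|x| - 1) ^+ 2 by exact: sqr_ge0.
    by rewrite sqrrB real_normK ?num_real//; lra.
under eq_integral do rewrite EFinD EFinM.
rewrite ge0_integralD//; last 2 first.
- by move=> x _; rewrite lee_fin mulr_ge0// sqr_ge0.
- by apply: emeasurable_funM.
rewrite ge0_integralZl//; last by move=> x _; rewrite lee_fin sqr_ge0.
rewrite normal_second_moment mule1 integral_cst//.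
rewrite [X in (_ * X + _)%E](_ : _ = 1%E); last exact: probability_setT.
by rewrite mule1 -EFinD lee_fin; lra.
Qed.

Lemma normal_integrable_id : G.-integrable [set: RR] (EFin \o id).
Proof.
apply/integrableP; split; first by apply/measurable_EFinP.
by rewrite (le_lt_trans normal_abs_le)// ltry.
Qed.

(** By symmetry the mean equals its own opposite, and it is finite. *)
Lemma normal_mean : (\int[G]_x x%:E = 0)%E.
Proof.
have mN : measurable_fun [set: RR] (fun x : RR => - x : RR) by exact: oppr_measurable.
pose nu := measure_function_pushforward__canonical__measure_function_Measure G mN.
have e : (\int[G]_x x%:E = \int[G]_x (- x)%:E)%E.
  transitivity (\int[nu]_x x%:E)%E.
    by apply: eq_measure_integral => A mA _; exact: (esym (normal_prob_opp A mA)).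
  rewrite integral_pushforward//.
  rewrite preimage_setT.
  apply/integrableP; split; first exact/measurable_EFinP.
  under eq_integral do rewrite /= normrN.
  exact: le_lt_trans normal_abs_le (ltry _).
have fin : (\int[G]_x x%:E)%E \is a fin_num.
  exact: integrable_fin_num normal_integrable_id.
move: e; under [in X in _ = X]eq_integral do rewrite EFinN.
rewrite integralN; last exact: integrable_add_def normal_integrable_id.
move: fin; case: (\int[G]_x x%:E)%E => [r| |]// _ [e].
by congr EFin; lra.
Qed.

Lemma standard_expectation d (T : measurableType d) (P : probability T R)
    (X : {RV P >-> R}) :
  (forall A : set R, measurable A -> P (X @^-1` A) = G A) ->
  ('E_P[X] = 0 /\ 'V_P[X] = 1)%E.
Proof.
move=> law.
(* [R] and [measurableTypeR R] have the same measurable sets but different displays. *)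
have mX : measurable_fun [set: T] (X : T -> RR).
  by move=> mT A mA; exact: (@measurable_funP _ _ _ _ setT X mT A mA).
pose nu := measure_function_pushforward__canonical__measure_function_Measure P mX.
have nuE (A : set RR) : measurable A -> A `<=` setT -> nu A = G A.
  by move=> mA _; exact: law.
have lawE (f : RR -> \bar R) : measurable_fun setT f -> (forall x, 0 <= f x)%E ->
    (\int[P]_t f (X t) = \int[G]_x f x)%E.
  move=> mf f0; rewrite -(eq_measure_integral _ nuE).
  by rewrite ge0_integral_pushforward.
have intX : P.-integrable setT (EFin \o X).
  apply/integrableP; split; first exact/measurable_EFinP.
  rewrite (lawE (fun x => `|x|%:E)) ?(le_lt_trans normal_abs_le) ?ltry//.
  by apply/measurable_EFinP; exact: normr_measurable.
have EX : ('E_P[X] = 0)%E.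
  rewrite expectation_def -[RHS]normal_mean -(eq_measure_integral _ nuE).
  by rewrite integral_pushforward.
split => //; rewrite /variance covariance.unlock EX/= unlock.
rewrite -normal_second_moment -lawE; last 2 first.
- by apply/measurable_EFinP; exact: measurable_funX.
- by move=> x; rewrite lee_fin sqr_ge0.
by apply: eq_integral => t _; rewrite !fctE/= subr0 expr2.
Qed.

End standard_law.

(** * Gaussian laws attached to the square *)

Section square_law.
Context {R : realType}.
Local Notation RR := (measurableTypeR R).
Local Notation G := (normal_prob (0:R) 1).
Local Notation Omega := (RR * RR * RR)%type.
Local Notation P := ((G \x G) \x G)%E.
Implicit Types tau : R.

Definition corner_x (i : 'I_4) : R :=
  match val i with 0%N => 1 | 2%N => -1 | _ => 0 end.
Definition corner_y (i : 'I_4) : R :=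
  match val i with 1%N => 1 | 3%N => -1 | _ => 0 end.

Lemma cornerE i w : corner i w = corner_x i * w.1 + corner_y i * w.2.
Proof.
by rewrite /corner /corner_x /corner_y; case: i => -[|[|[|[|//]]]] ? /=; ring.
Qed.

Lemma square_funE tau i t : square_fun tau i t =
  scale tau * tau * corner_x i * t.1.1 + scale tau * tau * corner_y i * t.1.2 +
  scale tau * t.2.
Proof. by rewrite /square_fun cornerE; ring. Qed.

Lemma square_gaussian tau : gaussian_vector (square_vector tau).
Proof.
move=> a; pose b := \sum_i a i * (scale tau * tau * corner_x i).
pose c := \sum_i a i * (scale tau * tau * corner_y i).
pose e := \sum_i a i * scale tau.
exists 0, (Num.sqrt (b ^+ 2 + c ^+ 2 + e ^+ 2)) => A mA.
rewrite (_ : _ @^-1` A =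
  (fun t : Omega => b * t.1.1 + c * t.1.2 + e * t.2) @^-1` A); first exact: law_linear.
congr (_ @^-1` A); apply/funext => t.
rewrite !mulr_suml -!big_split/=; apply: eq_bigr => i _.
by rewrite /square_vector/= square_funE; ring.
Qed.

Lemma law_square tau i (A : set R) : measurable A ->
  P (square_vector tau i @^-1` A) = G A.
Proof.
move=> mA; transitivity (gaussian_law 0 1 A); last first.
  by rewrite /gaussian_law oner_eq0.
rewrite (_ : square_vector tau i @^-1` A = (fun t : Omega =>
  scale tau * tau * corner_x i * t.1.1 + scale tau * tau * corner_y i * t.1.2 +
  scale tau * t.2) @^-1` A); last first.
  by congr (_ @^-1` A); apply/funext => t; exact: square_funE.
rewrite (law_linear _ _ _ _ mA); apply: eq_gaussian_law.
rewrite sqr_sqrtr ?addr_ge0 ?sqr_ge0// !exprMn scale_sqr.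
have t0 : 1 + tau ^+ 2 != 0 by rewrite gt_eqF// ltr_pwDl// sqr_ge0.
have -> : corner_y i ^+ 2 = 1 - corner_x i ^+ 2.
  by rewrite /corner_x /corner_y; case: i => -[|[|[|[|//]]]] ? /=; ring.
by field.
Qed.

Lemma square_standard tau : standard_gaussian_vector (square_vector tau).
Proof.
split; first exact: square_gaussian.
by move=> i; apply: standard_expectation => A mA; exact: law_square.
Qed.

(** The difference of two coordinates is a linear form in [U] and [V] alone, of positive variance
    since distinct corners differ, so its law does not charge 0. *)
Lemma square_nondegenerate tau : 0 < tau -> nondegenerate_vector (square_vector tau).
Proof.
move=> t0 i j ij.
have c0 := scale_gt0 tau.
pose A := (fun t : Omega => scale tau * tau * (corner_x i - corner_x j) * t.1.1 +
  scale tau * tau * (corner_y i - corner_y j) * t.1.2 + 0 * t.2) @^-1` [set 0].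
have AE : A = [set t | square_vector tau i t = square_vector tau j t].
  apply/seteqP; split => t; rewrite /A /square_vector/= !square_funE => h; last first.
    by rewrite (_ : _ + _ = (scale tau * tau * corner_x i * t.1.1 +
      scale tau * tau * corner_y i * t.1.2 + scale tau * t.2) -
      (scale tau * tau * corner_x j * t.1.1 +
      scale tau * tau * corner_y j * t.1.2 + scale tau * t.2)); [rewrite h subrr|ring].
  by apply/eqP; rewrite -subr_eq0 -[X in _ == X]h; apply/eqP; ring.
have mf : measurable_fun [set: Omega] (fun t : Omega =>
  scale tau * tau * (corner_x i - corner_x j) * t.1.1 +
  scale tau * tau * (corner_y i - corner_y j) * t.1.2 + 0 * t.2 : RR).
  by apply: measurable_funD; [apply: measurable_funD|]; apply: measurable_funM => //;
    apply: measurableT_comp.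
have mA : measurable A by rewrite -[A]setTI; exact: mf.
have -> : [set t | square_vector tau i t != square_vector tau j t] = ~` A.
  rewrite AE; apply/seteqP; split => t /= /eqP //.
rewrite probability_setC// [X in (_ - X)%E](_ : _ = 0%E) ?sube0//.
transitivity (gaussian_law 0 (Num.sqrt (
  (scale tau * tau * (corner_x i - corner_x j)) ^+ 2 +
  (scale tau * tau * (corner_y i - corner_y j)) ^+ 2 + 0 ^+ 2)) [set 0]).
  exact: law_linear.
rewrite /gaussian_law gt_eqF; first exact: integral_set1.
rewrite sqrtr_gt0 !exprMn expr0n addr0 -mulrDr mulr_gt0//.
  by rewrite mulr_gt0// exprn_gt0.
move: ij; rewrite /corner_x /corner_y -val_eqE.
by case: i {A AE mf mA} => -[|[|[|[|//]]]] ? /=; case: j => -[|[|[|[|//]]]] ? //= _; lra.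
Qed.

(** Opposite parity means that the corners are neighbours. Their sum then has squared length 2,
    which gives the midpoint a variance below 1 when [tau] is nonzero. *)
Lemma law_edge tau (i j : 'I_4) (A : set R) : odd i != odd j -> measurable A ->
  P ((fun t => (square_vector tau i t + square_vector tau j t) / 2) @^-1` A) =
  gaussian_law 0 (Num.sqrt ((1 + tau ^+ 2 / 2) / (1 + tau ^+ 2))) A.
Proof.
move=> ij mA.
rewrite (_ : _ @^-1` A = (fun t : Omega =>
  scale tau * tau * (corner_x i + corner_x j) / 2 * t.1.1 +
  scale tau * tau * (corner_y i + corner_y j) / 2 * t.1.2 +
  scale tau * t.2) @^-1` A); last first.
  by congr (_ @^-1` A); apply/funext => t; rewrite /square_vector/= !square_funE; field.
rewrite (law_linear _ _ _ _ mA); congr (gaussian_law 0 (Num.sqrt _) A).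
have t0 : 1 + tau ^+ 2 != 0 by rewrite gt_eqF// ltr_pwDl// sqr_ge0.
rewrite !exprMn scale_sqr.
have -> : (corner_y i + corner_y j) ^+ 2 = 2 - (corner_x i + corner_x j) ^+ 2.
  move: ij; rewrite /corner_x /corner_y.
  by case: i => -[|[|[|[|//]]]] ? /=; case: j => -[|[|[|[|//]]]] ? //= _; ring.
by field.
Qed.

End square_law.

(** * Symmetry of the patterns and their sections at fixed [(U, V)] *)

Section patterns.
Context {R : realType}.
Local Notation RR := (measurableTypeR R).
Local Notation G := (normal_prob (0:R) 1).
Local Notation Omega := (RR * RR * RR)%type.
Local Notation GG := (G \x G)%E.
Local Notation P := (GG \x G)%E.
Implicit Types tau h : R.

Definition quarter_turn (w : RR * RR) : RR * RR := (w.2, - w.1).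

Lemma measurable_quarter_turn : measurable_fun [set: RR * RR] quarter_turn.
Proof.
apply: measurable_fun_pair => //=.
have mN : measurable_fun [set: RR] (-%R : RR -> RR) by exact: oppr_measurable.
exact: (measurableT_comp mN measurable_fst).
Qed.

(** On rectangles this is the symmetry of the Gaussian law together with the equality of the two
    factors; uniqueness of the product measure does the rest. *)
Lemma quarter_turn_invariant (A : set (RR * RR)) : measurable A ->
  GG (quarter_turn @^-1` A) = GG A.
Proof.
move=> mA; pose nu := measure_function_pushforward__canonical__measure_function_Measure
  GG measurable_quarter_turn.
apply/esym; apply: (product_measure_unique (m' := nu)) => // {mA}A B mA mB.
rewrite /nu/= /pushforward.
have -> : quarter_turn @^-1` (A `*` B) = (-%R @^-1` B) `*` A.
  by apply/seteqP; split => -[u v] [].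
have mB' : measurable (-%R @^-1` B : set RR).
  by rewrite -[_ @^-1` _]setTI; exact: oppr_measurable.
by rewrite product_measure1E// muleC; congr (_ * _)%E; exact: normal_prob_opp.
Qed.

Definition rotation (t : Omega) : Omega := (quarter_turn t.1, t.2).

Lemma measurable_rotation : measurable_fun [set: Omega] rotation.
Proof.
apply: measurable_fun_pair => //=; apply: (measurableT_comp measurable_quarter_turn).
exact: measurable_fst.
Qed.

Lemma rotation_invariant (A : set Omega) : measurable A -> P (rotation @^-1` A) = P A.
Proof.
move=> mA; pose nu := measure_function_pushforward__canonical__measure_function_Measure
  P measurable_rotation.
have nuE (B : set (RR * RR)) (C : set RR) : measurable B -> measurable C ->
    nu (B `*` C) = (GG B * G C)%E.
  move=> mB mC; rewrite /nu/= /pushforward.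
  have -> : rotation @^-1` (B `*` C) = (quarter_turn @^-1` B) `*` C.
    by apply/seteqP; split => -[u v] [].
  have mB' : measurable (quarter_turn @^-1` B).
    by rewrite -[_ @^-1` _]setTI; exact: measurable_quarter_turn.
  rewrite -(quarter_turn_invariant B mB).
  exact: product_measure1E.
pose GGp : probability (RR * RR)%type R := GG.
by apply/esym; apply: (@product_measure_unique _ _ _ _ _ GGp G nu).
Qed.

Definition pattern tau h (b0 b1 b2 b3 : bool) : set Omega :=
  [set t | [/\ (h < square_fun tau o0 t) = b0, (h < square_fun tau o1 t) = b1,
               (h < square_fun tau o2 t) = b2 & (h < square_fun tau o3 t) = b3]].

Lemma measurable_above tau h i b : measurable [set t | (h < square_fun tau i t) = b].
Proof.
have m : measurable_fun [set: Omega] (fun t => h < square_fun tau i t).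
  by apply: measurable_fun_ltr => //; exact: measurable_square_fun.
rewrite (_ : [set t | _] = (fun t => h < square_fun tau i t) @^-1` [set b])//.
by rewrite -[_ @^-1` _]setTI; exact: m.
Qed.

Lemma measurable_pattern tau h b0 b1 b2 b3 : measurable (pattern tau h b0 b1 b2 b3).
Proof.
rewrite (_ : pattern _ _ _ _ _ _ =
  [set t | (h < square_fun tau o0 t) = b0] `&`
  [set t | (h < square_fun tau o1 t) = b1] `&`
  [set t | (h < square_fun tau o2 t) = b2] `&`
  [set t | (h < square_fun tau o3 t) = b3]).
  by do 3 (apply: measurableI; last exact: measurable_above); exact: measurable_above.
by apply/seteqP; split => t /=; [case|case=> -[[]]].
Qed.

(** A quarter turn of [(U, V)] replaces each corner by the next one and leaves [Z] fixed. *)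
Lemma pattern_rot tau h b0 b1 b2 b3 :
  P (pattern tau h b0 b1 b2 b3) = P (pattern tau h b3 b0 b1 b2).
Proof.
rewrite -rotation_invariant; last exact: measurable_pattern.
congr (P _); apply/seteqP; split => t;
  rewrite /pattern/= /square_fun /corner/= opprK; by case.
Qed.

Lemma above_section tau h i t : (h < square_fun tau i t) =
  (h / scale tau - tau * corner i t.1 < t.2).
Proof.
by rewrite /square_fun mulrC -ltr_pdivrMr ?scale_gt0// ltrBlDr.
Qed.

(** Averaging over a pair of opposite corners cancels [U] and [V]: one pair would give
    [Z > h / scale tau] and the other [Z <= h / scale tau]. *)
Lemma pattern_opposite tau h : 0 < h ->
  pattern tau h true false true false = set0 /\
  pattern tau h false true false true = set0.
Proof.
move=> h0; have s0 : 0 < h / scale tau by rewrite divr_gt0// scale_gt0.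
by split; apply/seteqP; split => // t [];
  rewrite !above_section /corner/= => /idP ? /negP ? /idP ? /negP ?; lra.
Qed.

(** With [s = h / scale tau], the conditions confine [z] to the interval from [s - tau u] to
    [s - tau |v|], nonempty exactly when [|v| < u]; there the bound [z <= s + tau u] is
    automatic. *)
Lemma xsection_1000 tau h w : 0 < tau ->
  G (xsection (pattern tau h true false false false) w) =
  (if `|w.2| < w.1
   then Phi (h / scale tau - tau * `|w.2|) - Phi (h / scale tau - tau * w.1) else 0)%:E.
Proof.
move=> t0; case: w => u v /=; set s := h / scale tau.
have -> : xsection (pattern tau h true false false false) (u, v) =
    [set z | [/\ s - tau * u < z, z <= s - tau * v, z <= s + tau * u & z <= s + tau * v]].
  apply/seteqP; split => z; rewrite /xsection/= inE /pattern/= !above_section /corner/= -/s.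
    rewrite !leNgt => -[-> -> h2 h3]; split => //; apply: negbT.
      by rewrite -h2; congr (_ < _); ring.
    by rewrite -h3; congr (_ < _); ring.
  case=> -> h1 h2 h3; split => //; apply/negbTE; rewrite -leNgt//.
    by apply: le_trans h2 _; rewrite le_eqVlt; apply/orP; left; apply/eqP; ring.
  by apply: le_trans h3 _; rewrite le_eqVlt; apply/orP; left; apply/eqP; ring.
case: ifPn => vu.
  rewrite -normal_prob_ocitv; last by rewrite lerB// ler_wpM2l// ltW.
  congr (normal_prob _ _ _); apply/seteqP; split => z /=; rewrite in_itv/=.
    move=> [-> h1 h2 h3]/=; case: (ler0P v) => v0; first by rewrite mulrN opprK.
    exact: h1.
  move=> /andP[-> hz].
  have v0 : 0 <= tau * `|v| by rewrite mulr_ge0// ltW.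
  have v1 : tau * v <= tau * `|v| by rewrite ler_wpM2l ?(ltW t0)// ler_norm.
  have v2 : - (tau * v) <= tau * `|v|.
    by rewrite -mulrN ler_wpM2l ?(ltW t0)// -normrN ler_norm.
  have v3 : tau * `|v| <= tau * u by rewrite ler_wpM2l ?(ltW t0) ?(ltW vu).
  by split => //; lra.
rewrite (_ : [set z | _] = set0) ?measure0// -subset0 => z /= [h0 h1 h2 h3].
move: vu; rewrite -leNgt => vu.
have : tau * u <= tau * `|v| by rewrite ler_wpM2l// ltW.
by case: (ler0P v) => v0; rewrite ?mulrN; lra.
Qed.

(** Here [z] runs from [s + tau |v|] to [s + tau u]. Taking 1101 instead of its rotation 0111 places
    the 0 opposite corner 0, so this section lives on the same region [|v| < u] as that of 1000. *)
Lemma xsection_1101 tau h w : 0 < tau ->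
  G (xsection (pattern tau h true true false true) w) =
  (if `|w.2| < w.1
   then Phi (h / scale tau + tau * w.1) - Phi (h / scale tau + tau * `|w.2|) else 0)%:E.
Proof.
move=> t0; case: w => u v /=; set s := h / scale tau.
have -> : xsection (pattern tau h true true false true) (u, v) =
    [set z | [/\ s - tau * u < z, s - tau * v < z, z <= s + tau * u & s + tau * v < z]].
  apply/seteqP; split => z; rewrite /xsection/= inE /pattern/= !above_section /corner/= -/s
    !mulrN !opprK.
    by move=> [-> -> h2 ->]; split => //; rewrite leNgt h2.
  by move=> [-> -> h2 ->]; split => //; apply/negbTE; rewrite -leNgt.
case: ifPn => vu.
  rewrite -normal_prob_ocitv; last by rewrite lerD2l ler_wpM2l// ltW.
  congr (normal_prob _ _ _); apply/seteqP; split => z /=; rewrite in_itv/=.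
    move=> [h0 h1 -> h3]/=; rewrite andbT; case: (ler0P v) => v0; last by [].
    by rewrite mulrN.
  move=> /andP[hz ->].
  have v0 : 0 <= tau * `|v| by rewrite mulr_ge0// ltW.
  have v1 : tau * v <= tau * `|v| by rewrite ler_wpM2l ?(ltW t0)// ler_norm.
  have v2 : - (tau * v) <= tau * `|v|.
    by rewrite -mulrN ler_wpM2l ?(ltW t0)// -normrN ler_norm.
  have v3 : tau * `|v| <= tau * u by rewrite ler_wpM2l ?(ltW t0) ?(ltW vu).
  by split => //; lra.
rewrite (_ : [set z | _] = set0) ?measure0// -subset0 => z /= [h0 h1 h2 h3].
move: vu; rewrite -leNgt => vu.
have : tau * u <= tau * `|v| by rewrite ler_wpM2l// ltW.
by case: (ler0P v) => v0; rewrite ?mulrN; lra.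
Qed.

End patterns.

(** * Bounds on the pattern probabilities *)

Section estimates.
Context {R : realType}.
Local Notation RR := (measurableTypeR R).
Local Notation G := (normal_prob (0:R) 1).
Local Notation phi := (normal_pdf (0:R) 1).
Local Notation Omega := (RR * RR * RR)%type.
Local Notation GG := (G \x G)%E.
Local Notation P := (GG \x G)%E.
Variables (tau h : R).
Hypotheses (tau0 : 0 < tau) (h0 : 0 < h).
Let s := h / scale tau.

Let s0 : 0 < s. Proof. by rewrite divr_gt0// scale_gt0. Qed.

Lemma integral_fst_sqr (k : R) : 0 <= k -> (\int[GG]_w (k * w.1 ^+ 2)%:E = k%:E)%E.
Proof.
move=> k0.
have m1 : measurable_fun [set: RR] (fun x : RR => (k * x ^+ 2)%:E).
  by apply/measurable_EFinP/measurable_funM => //; exact: measurable_funX.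
transitivity (\int[G]_x \int[G]_y (k * x ^+ 2)%:E)%E.
  rewrite (fubini_tonelli1 (fun w : RR * RR => (k * w.1 ^+ 2)%:E))//.
    exact: (measurableT_comp m1 measurable_fst).
  by move=> w; rewrite lee_fin mulr_ge0// sqr_ge0.
transitivity (\int[G]_x (k%:E * (x ^+ 2)%:E))%E.
  apply: eq_integral => x _; rewrite integral_cst//.
  by rewrite [X in (_ * X)%E](_ : _ = 1%E) ?mule1//; exact: probability_setT.
rewrite ge0_integralZl//.
- by rewrite normal_second_moment mule1.
- by apply/measurable_EFinP; exact: measurable_funX.
- by move=> x _; rewrite lee_fin sqr_ge0.
Qed.

Let measurable_sec (A : set Omega) : measurable A ->
  measurable_fun [set: RR * RR] (fun w => G (xsection A w)).
Proof. by move=> mA; exact: measurable_fun_xsection. Qed.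

(** This is [Delta >= 0], up to rotation: the two sections differ by [k (tau |v|) - k (tau u)],
    which is nonnegative by [Phi_window]. *)
Lemma pattern_1101_le : (P (pattern tau h true true false true) <=
  P (pattern tau h true false false false))%E.
Proof.
apply: ge0_le_integral => //.
- exact: measurable_sec (measurable_pattern _ _ _ _ _ _).
- exact: measurable_sec (measurable_pattern _ _ _ _ _ _).
move=> w _; rewrite /comp xsection_1101// xsection_1000//.
rewrite lee_fin; case: ifPn => // vu.
have /andP[+ _] := Phi_window s (tau * `|w.2|) (tau * w.1) (ltW s0)
  (mulr_ge0 (ltW tau0) (normr_ge0 _)) (ler_wpM2l (ltW tau0) (ltW vu)).
by rewrite -/s; lra.
Qed.

(** The upper bound of [Phi_window] makes the sections differ by at most [2 s tau^2 u^2], and [U]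
    has second moment 1. *)
Lemma pattern_1000_le : (P (pattern tau h true false false false) <=
  P (pattern tau h true true false true) + (2 * s * tau ^+ 2)%:E)%E.
Proof.
have k0 : 0 <= 2 * s * tau ^+ 2 by rewrite mulr_ge0 ?sqr_ge0// mulr_ge0// (ltW s0).
rewrite -(integral_fst_sqr _ k0) -ge0_integralD//; last 3 first.
- exact: measurable_sec (measurable_pattern _ _ _ _ _ _).
- by move=> w _; rewrite lee_fin mulr_ge0// sqr_ge0.
- apply/measurable_EFinP/measurable_funM => //; apply: measurable_funX.
  exact: measurable_fst.
apply: ge0_le_integral => //.
- exact: measurable_sec (measurable_pattern _ _ _ _ _ _).
- apply: emeasurable_funD.
    exact: measurable_sec (measurable_pattern _ _ _ _ _ _).
  apply/measurable_EFinP/measurable_funM => //; apply: measurable_funX.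
  exact: measurable_fst.
move=> w _; rewrite /comp xsection_1101// xsection_1000// -EFinD lee_fin.
case: ifPn => vu; last by rewrite add0r mulr_ge0// sqr_ge0.
have /andP[_] := Phi_window s (tau * `|w.2|) (tau * w.1) (ltW s0)
  (mulr_ge0 (ltW tau0) (normr_ge0 _)) (ler_wpM2l (ltW tau0) (ltW vu)).
by rewrite -/s exprMn mulrA; lra.
Qed.

(** Corner 0 above and corner 2 below confine [Z] to an interval of length
    [2 tau u <= tau (1 + u^2)], whose upper bound has mean [2 tau]. *)
Lemma pattern_10_le b1 b3 : (P (pattern tau h true b1 false b3) <= (2 * tau)%:E)%E.
Proof.
have -> : ((2 * tau)%:E = \int[GG]_w (tau%:E + (tau * w.1 ^+ 2)%:E))%E.
  rewrite ge0_integralD//.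
  - rewrite (integral_fst_sqr _ (ltW tau0)) integral_cst//.
    rewrite [X in (_ * X + _)%E](_ : _ = 1%E); last exact: probability_setT.
    by rewrite mule1 -EFinD; congr EFin; ring.
  - by move=> w _; rewrite lee_fin ltW.
  - by move=> w _; rewrite lee_fin mulr_ge0 ?(ltW tau0)// sqr_ge0.
  - apply/measurable_EFinP/measurable_funM => //; apply: measurable_funX.
    exact: measurable_fst.
apply: ge0_le_integral => //.
- exact: measurable_sec (measurable_pattern _ _ _ _ _ _).
- apply: emeasurable_funD => //.
  apply/measurable_EFinP/measurable_funM => //; apply: measurable_funX.
  exact: measurable_fst.
case=> u v _; rewrite /comp.
have msec : measurable (xsection (pattern tau h true b1 false b3) (u, v)).
  by apply: measurable_xsection; exact: measurable_pattern.
have sub : xsection (pattern tau h true b1 false b3) (u, v) `<=`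
    `]s - tau * u, s + tau * u]%classic.
  move=> z; rewrite /xsection/= inE /pattern/= !above_section /corner/= -/s.
  move=> [h1 _ /negbT h2 _]; rewrite in_itv/= h1/= leNgt; move: h2.
  by rewrite mulrN opprK.
apply: (@le_trans _ _ (G `]s - tau * u, s + tau * u]%classic)).
  by apply: le_measure => //; rewrite inE.
have u1 : 2 * u <= 1 + u ^+ 2.
  by have := sqr_ge0 (u - 1); rewrite sqrrB; lra.
have [u0|u0] := leP 0 u.
  have uu : s - tau * u <= s + tau * u by rewrite lerD2l ge0_cp ?mulr_ge0// ltW.
  rewrite normal_prob_ocitv// -EFinD lee_fin (le_trans (Phi_sub_le _ _ uu))//.
  by have := ler_wpM2l (ltW tau0) u1; rewrite /=; lra.
rewrite set_itv_ge ?measure0.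
  by rewrite -EFinD lee_fin addr_ge0 ?(ltW tau0)// mulr_ge0 ?(ltW tau0)// sqr_ge0.
have tu : tau * u < 0 by rewrite pmulr_rlt0.
by rewrite bnd_simp -leNgt; lra.
Qed.

(** On the cube with sides [[-3, 3]] the joint density is at least [phi 3 ^+ 3]. *)
Let cube_ge (a b c d e f : R) : -3 <= a <= b -> b <= 3 -> -3 <= c <= d -> d <= 3 ->
  -3 <= e <= f -> f <= 3 ->
  ((phi 3 ^+ 3 * ((b - a) * (d - c) * (f - e)))%:E <=
   P ((`]a, b] `*` `]c, d]) `*` `]e, f]))%E.
Proof.
move=> /andP[a3 ab] b3 /andP[c3 cd] d3 /andP[e3 ef] f3.
rewrite (_ : P _ = (G `]a, b] * G `]c, d] * G `]e, f])%E); last first.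
  rewrite product_measure1E//; last exact: measurableX.
  by congr (_ * _)%E; exact: product_measure1E.
rewrite (normal_prob_ocitv _ _ ab) (normal_prob_ocitv _ _ cd) (normal_prob_ocitv _ _ ef).
rewrite -!EFinM lee_fin.
have p0 := ltW (phi_gt0 (3 : R)).
have -> : phi 3 ^+ 3 * ((b - a) * (d - c) * (f - e)) =
  (phi 3 * (b - a)) * (phi 3 * (d - c)) * (phi 3 * (f - e)) by ring.
by rewrite !ler_pM ?mulr_ge0 ?subr_ge0// ?Phi_sub_ge.
Qed.

Lemma pattern_1101_ge : s + 2 * tau <= 3 ->
  ((phi 3 ^+ 3 * tau)%:E <= P (pattern tau h true true false true))%E.
Proof.
move=> st3.
(* This box of volume [2 tau] lies in the pattern, since there [|v| <= 1] and [u > 2]; the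
   hypothesis keeps it inside the cube. *)
apply: (@le_trans _ _ (P ((`]2, 3] `*` `]-1, 1]) `*` `]s + tau, s + 2 * tau]))).
  have s_gt0 := s0; have t_gt0 := tau0; apply: le_trans (cube_ge _ _ _ _ _ _ _ _ _ _ _ _);
    rewrite ?lee_fin; try (try apply/andP; try split; lra).
  rewrite ler_wpM2l//; first by rewrite exprn_ge0// ltW// phi_gt0.
  by rewrite [leRHS](_ : _ = 2 * tau); [lra|ring].
apply: le_measure; rewrite ?inE; first by do 2 (apply: measurableX => //).
  exact: measurable_pattern.
move=> [[u v] z] [[]] /=; rewrite !in_itv/= => /andP[u2 u3] /andP[v1 v2] /andP[z1 z2].
rewrite /pattern/= !above_section /corner/= -/s !mulrN !opprK.
by split; [apply/idP|apply/idP|apply/negbTE; rewrite -leNgt|apply/idP]; nra.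
Qed.

Lemma pattern_1100_ge : s + 2 * tau <= 3 ->
  ((phi 3 ^+ 3 * tau)%:E <= P (pattern tau h true true false false))%E.
Proof.
move=> st3.
(* Again a box of volume [2 tau]: with [u] and [v] above 1, corners 0 and 1 exceed the threshold and
   corners 2 and 3 do not. *)
apply: (@le_trans _ _ (P ((`]1, 2] `*` `]1, 2]) `*` `]s - tau, s + tau]))).
  have s_gt0 := s0; have t_gt0 := tau0; apply: le_trans (cube_ge _ _ _ _ _ _ _ _ _ _ _ _);
    rewrite ?lee_fin; try (try apply/andP; try split; lra).
  rewrite ler_wpM2l//; first by rewrite exprn_ge0// ltW// phi_gt0.
  by rewrite [leRHS](_ : _ = 2 * tau); [lra|ring].
apply: le_measure; rewrite ?inE; first by do 2 (apply: measurableX => //).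
  exact: measurable_pattern.
move=> [[u v] z] [[]] /=; rewrite !in_itv/= => /andP[u2 u3] /andP[v1 v2] /andP[z1 z2].
rewrite /pattern/= !above_section /corner/= -/s !mulrN !opprK.
by split; [apply/idP|apply/idP|apply/negbTE; rewrite -leNgt
  |apply/negbTE; rewrite -leNgt]; nra.
Qed.

End estimates.

(** * Small and large thresholds *)

Section small_threshold.
Context {R : realType}.
Local Notation RR := (measurableTypeR R).
Local Notation G := (normal_prob (0:R) 1).
Local Notation phi := (normal_pdf (0:R) 1).
Local Notation Omega := (RR * RR * RR)%type.
Local Notation GG := (G \x G)%E.
Local Notation P := (GG \x G)%E.
Implicit Types tau h : R.

Lemma sum_bool4 (V : nmodType) (F : bool -> bool -> bool -> bool -> V) :
  \sum_(b : bool * bool * bool * bool) F b.1.1.1 b.1.1.2 b.1.2 b.2 =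
  \sum_b0 \sum_b1 \sum_b2 \sum_b3 F b0 b1 b2 b3.
Proof.
rewrite -(pair_bigA _ (fun b b3 => F b.1.1 b.1.2 b.2 b3))/=.
rewrite -(pair_bigA _ (fun b b2 => \sum_b3 F b.1 b.2 b2 b3))/=.
by rewrite -(pair_bigA _ (fun b0 b1 => \sum_b2 \sum_b3 F b0 b1 b2 b3)).
Qed.

Lemma pattern_sum tau h (q : bool -> bool -> bool -> bool -> R)
    (E : bool -> bool -> bool -> bool -> bool) :
  (forall b0 b1 b2 b3, P (pattern tau h b0 b1 b2 b3) = (q b0 b1 b2 b3)%:E) ->
  P [set t | E (h < square_fun tau o0 t) (h < square_fun tau o1 t)
               (h < square_fun tau o2 t) (h < square_fun tau o3 t)] =
  (\sum_b0 \sum_b1 \sum_b2 \sum_b3 (if E b0 b1 b2 b3 then q b0 b1 b2 b3 else 0))%:E.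
Proof.
move=> qE; pose Y t := (h < square_fun tau o0 t, h < square_fun tau o1 t,
             h < square_fun tau o2 t, h < square_fun tau o3 t).
have YE b : [set t | Y t = b] = pattern tau h b.1.1.1 b.1.1.2 b.1.2 b.2.
  apply/seteqP; split => t /=; first by move=> <-.
  by case: b => -[[b0 b1] b2] b3 [/= <- <- <- <-].
rewrite -(sum_bool4 _ (fun b0 b1 b2 b3 => if E b0 b1 b2 b3 then q b0 b1 b2 b3 else 0)).
rewrite -big_mkcond/= -sumEFin.
transitivity (\sum_(b : bool * bool * bool * bool | E b.1.1.1 b.1.1.2 b.1.2 b.2)
  (P : probability Omega R) [set t | Y t = b])%E.
  rewrite -(probability_finite_values _ _ _ _ _ Y (fun b => E b.1.1.1 b.1.1.2 b.1.2 b.2))//.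
  by move=> b; rewrite YE; exact: measurable_pattern.
by apply: eq_bigr => b _; rewrite YE; exact: qE.
Qed.

Lemma above_prob tau h i : P [set t | h < square_fun tau i t] = (1 - Phi h)%:E.
Proof.
transitivity (G `]h, +oo[%classic); last exact: normal_prob_oy.
rewrite (_ : [set t | _] = square_vector tau i @^-1` `]h, +oo[).
  exact: law_square.
by apply/seteqP; split => t /=; rewrite in_itv/= andbT.
Qed.

(** Rotations reduce the nonconstant patterns to one orbit for each of [n1], [n2], [n3], besides the
    two impossible patterns. The marginal then gives 1111 and the total mass gives 0000. *)
Lemma square_pattern_pmf tau h (q : bool -> bool -> bool -> bool -> R) b0 b1 b2 b3 :
  0 < h ->
  (forall b0 b1 b2 b3, P (pattern tau h b0 b1 b2 b3) = (q b0 b1 b2 b3)%:E) ->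
  q b0 b1 b2 b3 = square_pmf (1 - Phi h) (q true false false false)
    (q true true false false) (q true true false true) b0 b1 b2 b3.
Proof.
move=> h0 qE.
have rot c0 c1 c2 c3 : q c0 c1 c2 c3 = q c3 c0 c1 c2.
  apply: EFin_inj; rewrite -!qE; exact: pattern_rot.
have [z1 z2] : q true false true false = 0 /\ q false true false true = 0.
  have [e1 e2] := pattern_opposite tau h h0.
  have P0 : P set0 = 0%E by exact: (measure0 (P : probability Omega R)).
  by split; apply: EFin_inj; rewrite -qE ?e1 ?e2.
have marginal := pattern_sum tau h q (fun c0 _ _ _ => c0) qE.
rewrite (above_prob tau h o0) in marginal.
have total := pattern_sum tau h q (fun _ _ _ _ => true) qE.
rewrite (_ : [set t : Omega | true] = setT) in total; last by apply/seteqP; split.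
rewrite [LHS](probability_setT (P : probability Omega R)) in total.
have {marginal} := EFin_inj marginal; have {total} := EFin_inj total.
have e1 : q false true false false = q true false false false by rewrite rot rot rot.
have e2 : q false false true false = q true false false false by rewrite rot rot.
have e3 : q false false false true = q true false false false by rewrite rot.
have e4 : q false true true false = q true true false false by rewrite rot rot rot.
have e5 : q false false true true = q true true false false by rewrite rot rot.
have e6 : q true false false true = q true true false false by rewrite rot.
have e7 : q true true true false = q true true false true by rewrite rot rot rot.
have e8 : q false true true true = q true true false true by rewrite rot rot.
have e9 : q true false true true = q true true false true by rewrite rot.
pose e := (z1, z2, (e1, e2, e3), (e4, e5, e6), (e7, e8, e9)).
rewrite !big_bool/= !e => total marginal; rewrite /square_pmf.
by case: b0; case: b1; case: b2; case: b3; rewrite /= ?e//; lra.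
Qed.

Lemma I4_cases (i : 'I_4) : [\/ i = o0, i = o1, i = o2 | i = o3].
Proof.
by case: i => -[|[|[|[|//]]]] i4;
  [constructor 1|constructor 2|constructor 3|constructor 4]; exact: val_inj.
Qed.

Lemma above_event tau h (y : {ffun 'I_4 -> bool}) :
  [set t | forall i, thresholdRV (square_vector tau i) h t = y i] =
  pattern tau h (y o0) (y o1) (y o2) (y o3).
Proof.
apply/seteqP; split => t /=; first by move=> ty; split; exact: ty.
move=> [t0 t1 t2 t3] i; have [->|->|->|->] := I4_cases i.
- exact: t0.
- exact: t1.
- exact: t2.
- exact: t3.
Qed.

(** The bound [h < 1 / 4] puts [p] between 1/4 and 1/2, so [p (1 - p) >= 3 / 16], while
    [tau <= 1 / 96] gives [4 n1 + 2 n2 <= 12 tau <= 1 / 8]. The bound [tau <= phi 3 ^+ 4] serves the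
    comparison of Delta with [n2] and [n3]. *)
Lemma small_threshold_color tau h : 0 < tau -> tau <= 1 / 96 -> tau <= phi 3 ^+ 4 ->
  0 < h < 1 / 4 ->
  color_process (fun i => thresholdRV (square_vector tau i) h).
Proof.
move=> tau0 tau1 tauphi /andP[h0 h1].
set d := phi 3 in tauphi; have d0 : 0 < d by exact: phi_gt0.
set s := h / scale tau.
have s2 : s <= 2 * h.
  rewrite /s /scale invrK mulrC ler_wpM2r ?(ltW h0)//.
  have -> : 2 = Num.sqrt (2 ^+ 2) :> R by rewrite sqrtr_sqr ger0_norm.
  by rewrite ler_wsqrtr//; nra.
have [q qE] : exists q : bool -> bool -> bool -> bool -> R,
    forall b0 b1 b2 b3, P (pattern tau h b0 b1 b2 b3) = (q b0 b1 b2 b3)%:E.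
  exists (fun b0 b1 b2 b3 => fine (P (pattern tau h b0 b1 b2 b3))) => b0 b1 b2 b3.
  have m := measurable_pattern tau h b0 b1 b2 b3.
  by rewrite fineK//; exact: (@fin_num_measure _ _ _ (P : probability Omega R) _ m).
have st : s + 2 * tau <= 3 by lra.
have l1 : q true true false true <= q true false false false.
  by rewrite -lee_fin -!qE; exact: pattern_1101_le.
have l2 : q true false false false <= q true true false true + 2 * s * tau ^+ 2.
  by rewrite -lee_fin EFinD -!qE; exact: pattern_1000_le.
have l3 : q true false false false <= 2 * tau.
  by rewrite -lee_fin -!qE; exact: pattern_10_le.
have l4 : q true true false false <= 2 * tau.
  by rewrite -lee_fin -!qE; exact: pattern_10_le.
have l5 : d ^+ 3 * tau <= q true true false true.
  by rewrite -lee_fin -!qE; exact: pattern_1101_ge.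
have l6 : d ^+ 3 * tau <= q true true false false.
  by rewrite -lee_fin -!qE; exact: pattern_1100_ge.
(* Here [1 - 2 p = 2 Phi h - 1], which is of order [h] since the density is at least [d] between 0
   and [h]. *)
have p1 : 2 * h * d <= 2 * Phi h - 1.
  have := Phi_sub_ge 3 0 h; rewrite Phi0 -/d subr0 => l; have : d * h <= Phi h - 1 / 2.
    by apply: l; lra.
  by lra.
have p2 : Phi h <= 3 / 4.
  by have := Phi_sub_le 0 h (ltW h0); rewrite Phi0; lra.
have hd0 : 0 < h * d by rewrite mulr_gt0.
(* The left side, which bounds Delta, is at most [4 h tau^2]; replacing one [tau] by [d ^+ 4] gives
   twice the product of the lower bounds [2 h d] for [1 - 2 p] and [d ^+ 3 * tau] for [n]. *)
have key n : d ^+ 3 * tau <= n -> 2 * s * tau ^+ 2 <= 2 * (1 - 2 * (1 - Phi h)) * n.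
  move=> ln; apply: (@le_trans _ _ (4 * h * tau * tau)).
    rewrite expr2 mulrA ler_wpM2r ?(ltW tau0)// ler_wpM2r ?(ltW tau0)//; lra.
  apply: (@le_trans _ _ (4 * h * tau * d ^+ 4)).
    by rewrite ler_wpM2l// !mulr_ge0// ltW.
  have -> : 4 * h * tau * d ^+ 4 = (2 * (2 * h * d)) * (d ^+ 3 * tau) by ring.
  rewrite ler_pM//; last by lra.
    by rewrite !mulr_ge0// ltW.
  by rewrite mulr_ge0 ?exprn_ge0// ltW.
have [||||||mu [mu_partition muE]] := square_color (1 - Phi h) (q true false false false)
  (q true true false false) (q true true false true).
- by lra.
- by lra.
- by rewrite subr_ge0.
- by rewrite (le_trans _ (key _ l5))// lerBlDr addrC.
- by rewrite (le_trans _ (key _ l6))// lerBlDr addrC.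
- by nra.
exists (1 - Phi h), mu; split => // [|y]; first by lra.
rewrite muE -(square_pattern_pmf tau h q)// above_event.
exact: qE.
Qed.

End small_threshold.

(** * Large thresholds: no color representation *)

Section large_threshold.
Context {R : realType}.
Local Notation RR := (measurableTypeR R).
Local Notation G := (normal_prob (0:R) 1).
Local Notation Omega := (RR * RR * RR)%type.
Local Notation GG := (G \x G)%E.
Local Notation P := (GG \x G)%E.
Implicit Types tau h : R.

Definition edge_event tau h (i j : 'I_4) : set Omega :=
  [set t | h < (square_vector tau i t + square_vector tau j t) / 2].

Lemma measurable_edge_event tau h i j : measurable (edge_event tau h i j).
Proof.
have m : measurable_fun [set: Omega]
    (fun t => (square_fun tau i t + square_fun tau j t) / 2).
  by apply: measurable_funM => //; apply: measurable_funD; exact: measurable_square_fun.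
have -> : edge_event tau h i j =
    (fun t => (square_fun tau i t + square_fun tau j t) / 2) @^-1` `]h, +oo[%classic.
  by apply/seteqP; split => t; rewrite /edge_event/= in_itv/= andbT.
by rewrite -[X in measurable X]setTI; exact: m.
Qed.

Lemma edge_event_prob tau h (i j : 'I_4) : odd i != odd j -> P (edge_event tau h i j) =
  gaussian_law 0 (Num.sqrt ((1 + tau ^+ 2 / 2) / (1 + tau ^+ 2))) `]h, +oo[%classic.
Proof.
move=> ij; rewrite (_ : edge_event tau h i j =
  (fun t => (square_vector tau i t + square_vector tau j t) / 2) @^-1` `]h, +oo[).
  exact: law_edge.
by apply/seteqP; split => t; rewrite /edge_event/= in_itv/= andbT.
Qed.

Lemma large_threshold_not_color tau : 0 < tau -> exists2 h1 : R, 0 < h1 &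
  forall h, h1 < h -> ~ color_process (fun i => thresholdRV (square_vector tau i) h).
Proof.
move=> tau0; set S := Num.sqrt ((1 + tau ^+ 2 / 2) / (1 + tau ^+ 2)).
have t2 : 0 < tau ^+ 2 by rewrite exprn_gt0.
have S0 : 0 < S by rewrite sqrtr_gt0 divr_gt0//; lra.
have S1 : S < 1.
  by rewrite -[ltRHS]sqrtr1 ltr_sqrt// ltr_pdivrMr; lra.
(* The square has four sides, and 1/8 for each makes the union bound [p / 2], short of [p]. *)
have [h1 h10 tail] := normal_tail_le S (1 / 8) S0 S1 ltac:(lra).
exists h1 => // h hh1 [p [mu [p01 mu_part muE]]].
have h0 : 0 < h by exact: lt_trans hh1.
pose Y (t : Omega) : {ffun 'I_4 -> bool} := [ffun i => h < square_fun tau i t].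
have YE (y : {ffun 'I_4 -> bool}) : [set t | Y t = y] =
    [set t | forall i, thresholdRV (square_vector tau i) h t = y i].
  apply/seteqP; split => t /=; first by move=> <- i; rewrite ffunE.
  by move=> ty; apply/ffunP => i; rewrite ffunE -ty.
have mY y : measurable [set t | Y t = y].
  by rewrite YE above_event; exact: measurable_pattern.
have sumE (E : pred {ffun 'I_4 -> bool}) :
    P [set t | E (Y t)] = (\sum_(y | E y) color_pmf p mu y)%:E.
  rewrite -sumEFin.
  transitivity (\sum_(y | E y) (P : probability Omega R) [set t | Y t = y])%E.
    exact: (probability_finite_values _ _ _ P _ Y E mY).
  by apply: eq_bigr => y _; rewrite YE; exact: muE.
have pE : p = 1 - Phi h.
  apply: EFin_inj; rewrite -(above_prob tau h o0) -(color_pmf_marginal p mu o0)//.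
  rewrite -(sumE (fun y => y o0)); congr (P _).
  by apply/seteqP; split => t; rewrite /= ffunE.
(* Strictness at 1 comes from [Phi h < Phi (h + 1) <= 1], the density being positive. *)
have Ph : 0 < Phi h < 1.
  have [z _ zE] := Phi_mean_value h (h + 1) ltac:(lra).
  have z0 := phi_gt0 z; have P1 := PhiN (h + 1).
  have P0 : 0 <= Phi (- (h + 1)) by exact: fine_ge0.
  have := le_Phi 0 h (ltW h0); rewrite Phi0 => Ph.
  by apply/andP; split; lra.
(* The impossible pattern 1010; it takes different values at two corners exactly when they are
   neighbours. *)
pose a : {ffun 'I_4 -> bool} := [ffun i : 'I_4 => ~~ odd i].
have a0 : color_pmf p mu a = 0.
  apply: EFin_inj; rewrite -muE above_event !ffunE/=.
  have [-> _] := pattern_opposite tau h h0.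
  exact: (measure0 (P : probability Omega R)).
have := color_pmf_eq0_le p mu a _ mu_part a0.
have : (\sum_(y : {ffun 'I_4 -> bool} | [exists i, exists j, [&& a i != a j, y i & y j]])
         color_pmf p mu y <= p / 2).
  rewrite -lee_fin -sumE.
  (* If two neighbours exceed [h], so does their mean; the four sides exhaust the neighbouring
     pairs. *)
  apply: (@le_trans _ _ (P (edge_event tau h o0 o1 `|` edge_event tau h o0 o3 `|`
    (edge_event tau h o2 o1 `|` edge_event tau h o2 o3)))).
    apply: le_measure; rewrite ?inE.
    - rewrite (_ : [set t | _] = [set t | Y t \in enum (fun y : {ffun 'I_4 -> bool} =>
        [exists i, exists j, [&& a i != a j, y i & y j]])]).
        exact: measurable_finite_values.
      by apply/seteqP; split => t /=; rewrite mem_enum.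
    - by apply: measurableU; apply: measurableU; exact: measurable_edge_event.
    move=> t /existsP[i /existsP[j]] /and3P[]; rewrite !ffunE.
    case: (I4_cases i) => ->; case: (I4_cases j) => ->; rewrite ?eqxx//= => _ hi hj;
      [left;left|left;right|left;left|right;left|right;left|right;right|left;right
      |right;right];
      rewrite /edge_event/= /square_vector/=; lra.
  have e (i j : 'I_4) : odd i != odd j -> (P (edge_event tau h i j) <= (p / 8)%:E)%E.
    move=> ij; rewrite edge_event_prob// /gaussian_law gt_eqF//.
    rewrite (le_trans (tail _ hh1))// normal_prob_oy -pE -EFinM lee_fin; lra.
  have -> : p / 2 = (p / 8 + p / 8) + (p / 8 + p / 8) by lra.
  have mE i j := measurable_edge_event tau h i j.
  apply: (le_trans (measureU2 _ _ _)); [exact: measurableU|exact: measurableU|].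
  rewrite EFinD; apply: leeD.
    by apply: (le_trans (measureU2 _ _ _)) => //; rewrite EFinD; apply: leeD; exact: e.
  by apply: (le_trans (measureU2 _ _ _)) => //; rewrite EFinD; apply: leeD; exact: e.
move=> s1 s2; have : 0 < p < 1 by rewrite pE; lra.
move=> p01'; have := s2 p01'; lra.
Qed.

End large_threshold.

Theorem theorem1p2 (R : realType) :
  exists (d : measure_display) (T : measurableType d) (P : probability T R)
         (X : 'I_4 -> {RV P >-> R}),
    [/\ standard_gaussian_vector X,
        nondegenerate_vector X
      & exists h0 h1 : R,
          [/\ 0 < h0, h0 <= h1,
              forall h : R, 0 < h < h0 ->
                color_process (fun i => thresholdRV (X i) h)
            & forall h : R, h1 < h ->
                ~ color_process (fun i => thresholdRV (X i) h)]].
Proof.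
(* As [d <= 1], this [tau] is below both 1/96 and [d ^+ 4]. *)
pose d : R := normal_pdf 0 1 3; pose tau := d ^+ 4 / 96.
have d0 : 0 < d by exact: phi_gt0.
have d41 : d ^+ 4 <= 1 by rewrite exprn_ile1// ?(ltW d0)//; exact: phi_le1.
have d40 : 0 < d ^+ 4 by rewrite exprn_gt0.
have tau0 : 0 < tau by rewrite divr_gt0.
have [h1 h10 large] := large_threshold_not_color tau tau0.
do 3 eexists; exists (square_vector tau); split.
- exact: square_standard.
- exact: square_nondegenerate.
(* Adding 1/4 to [h1] secures the order of the two thresholds. *)
exists (1 / 4), (1 / 4 + h1); split; [by lra|by lra| |].
- move=> h h01; apply: small_threshold_color => //.
    by rewrite ler_wpM2r.
  by rewrite ler_piMr ?(ltW d40)//; lra.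
- by move=> h hh1; apply: large; lra.
Qed.
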